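(* For integers $g,n$, the stack $\overline{\mathscr J}_{\mathrm{bd}}^{2,g,n}$ is universally closed (over $\mathrm{Spec}\,\mathbf k$).
   Context: Work over a field $\mathbf k$ of characteristic $\neq 2$. A linear binary quadratic form on a scheme $S$ is a triple $(V,L,p)$ with $V$ a rank $2$ vector bundle, $L$ a line bundle and $p\in H^0(S,\mathrm{Sym}^2V\otimes L)$; isomorphisms are pairs of isomorphisms $V\cong V'$, $L\cong L'$ carrying $p$ to $p'$. For integers $g,n$, $\overline{\mathscr J}^{2,g,n}$ is the stack over $\mathbf k$ whose $T$-points are linear binary quadratic forms $(V,L,p)$ on $\mathbb P^1_T$ with $\deg V+\deg L-1=g$ and $2\deg V+\deg L=n$ on fibers over $T$. So $\deg V=d:=n-g-1$ and $\deg L=k:=2g-n+2$. (Under a known equivalence, these are the same as pairs $(f:C\to\mathbb P^1_T,M)$ with $f$ finite flat of degree $2$ with fibers $C_t$ of arithmetic genus $g$, and $M$ a traceable $\mathcal O_C$-module of degree $\chi(M)-\chi(\mathcal O_C)=n$ on fibers; here $M$ is traceable if $f_*M$ is locally free of rank $2$ and the trace maps $f_*\mathcal O_C\to\mathcal O_{\mathbb P^1_T}$ obtained from the actions on $f_*M$ and on $f_*\mathcal O_C$ agree.) The open substack $\overline{\mathscr J}_{\mathrm{bd}}^{2,g,n}\subseteq\overline{\mathscr J}^{2,g,n}$ is the preimage, under $(V,L,p)\mapsto V$, of the open substack of the moduli stack of rank $2$, degree $d$ vector bundles on $\mathbb P^1$ parametrizing those $V$ with $\mathrm{Sym}^2(V)\otimes\mathcal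 O(k)$ globally generated (with $k=2g-n+2$). That is, its points are the forms $(\mathcal O(i)\oplus\mathcal O(j),\mathcal O(k),p)$ with $i\le j$ and $2i+k\ge 0$. *)

(* Defs.v *)
From HB Require Import structures.
From mathcomp Require Import all_boot all_order all_algebra.

Set Implicit Arguments.
Unset Strict Implicit.
Unset Printing Implicit Defensive.

Import GRing.Theory.
Local Open Scope ring_scope.

(** * Modules *)

Definition semilinear (R R' : nzRingType) (phi : R -> R')
    (M : lmodType R) (M' : lmodType R') (u : M -> M') : Prop :=
  forall (a : R) (x y : M), u (a *: x + y) = phi a *: u x + u y.

(* [u] exhibits [M'] as [R' (x)_R M], by the universal property. *)
Definition is_basechange (R R' : nzRingType) (phi : R -> R')
    (M : lmodType R) (M' : lmodType R') (u : M -> M') : Prop :=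
  semilinear phi u /\
  forall (N : lmodType R') (v : M -> N), semilinear phi v ->
    (exists h : {linear M' -> N}, forall x, h (u x) = v x) /\
    (forall h h' : {linear M' -> N},
       (forall x, h (u x) = h' (u x)) -> h =1 h').

Definition is_basis (R : nzRingType) (M : lmodType R) (r : nat)
    (e : 'I_r -> M) : Prop :=
  (forall m, exists c : 'I_r -> R, m = \sum_i c i *: e i) /\
  (forall c : 'I_r -> R, \sum_i c i *: e i = 0 -> forall i, c i = 0).

(* The localization of [M] at [f] is free with basis the images of [e];
   up to powers of the unit [f], every basis of the localization is of
   this form. *)
Definition is_local_basis (R : comNzRingType) (M : lmodType R) (r : nat)
    (f : R) (e : 'I_r -> M) : Prop :=
  (forall m, exists (N : nat) (c : 'I_r -> R),
     f ^+ N *: m = \sum_i c i *: e i) /\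
  (forall c : 'I_r -> R, \sum_i c i *: e i = 0 ->
     exists N : nat, forall i, f ^+ N * c i = 0).

Definition locally_free (R : comNzRingType) (r : nat) (M : lmodType R) : Prop :=
  exists (s : nat) (f a : 'I_s -> R),
    \sum_i a i * f i = 1 /\
    forall i, exists e : 'I_r -> M, is_local_basis (f i) e.

Definition sym_trilinear (R : comNzRingType) (V L S : lmodType R)
    (mu : V -> V -> L -> S) : Prop :=
  [/\ forall a v v' w l,
        mu (a *: v + v') w l = a *: mu v w l + mu v' w l,
      forall v w l, mu v w l = mu w v l
    & forall a v w l l',
        mu v w (a *: l + l') = a *: mu v w l + mu v w l'].

(* [mu] exhibits [S] as [Sym^2 V (x) L], by the universal property. *)
Definition is_sym2_tensor (R : comNzRingType) (V L S : lmodType R)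
    (mu : V -> V -> L -> S) : Prop :=
  sym_trilinear mu /\
  forall (N : lmodType R) (beta : V -> V -> L -> N), sym_trilinear beta ->
    (exists h : {linear S -> N}, forall v w l, h (mu v w l) = beta v w l) /\
    (forall h h' : {linear S -> N},
       (forall v w l, h (mu v w l) = h' (mu v w l)) -> h =1 h').

(** * Quasi-coherent sheaves on the projective line over a ring *)

(* The projective line over A is glued from U0 = Spec A[t], U1 = Spec A[s]
   along U01 = Spec A[t,1/t], with s = 1/t.  A quasi-coherent sheaf is given by
   its sections on U0, U1, U01 and the restriction maps.  The variable 'X is t
   on U0 and U01, and s on U1; an A[t,1/t]-module is an A[t]-module on which t
   is bijective.  The last four fields say that the sections on U01 are the
   localizations of those on U0 at t and of those on U1 at s. *)
Record p1sheaf (A : comNzRingType) := P1Sheaf {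
  sec0 : lmodType {poly A};
  sec1 : lmodType {poly A};
  sec01 : lmodType {poly A};
  res0 : sec0 -> sec01;
  res1 : sec1 -> sec01;
  sec01_bij : bijective (fun y : sec01 => 'X *: y);
  res0_linear : forall (a : {poly A}) (x y : sec0),
    res0 (a *: x + y) = a *: res0 x + res0 y;
  res1_Alinear : forall (a : A) (x y : sec1),
    res1 (a%:P *: x + y) = a%:P *: res1 x + res1 y;
  res1_X : forall x : sec1, 'X *: res1 ('X *: x) = res1 x;
  res0_ker : forall x : sec0, res0 x = 0 -> exists n : nat, 'X^n *: x = 0;
  res0_onto : forall y : sec01, exists (n : nat) (x : sec0),
    'X^n *: y = res0 x;
  res1_ker : forall x : sec1, res1 x = 0 -> exists n : nat, 'X^n *: x = 0;
  res1_onto : forall y : sec01, exists (n : nat) (x : sec1),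
    y = 'X^n *: res1 x
}.

Record global_section (A : comNzRingType) (F : p1sheaf A) := GlobalSection {
  gs0 : sec0 F;
  gs1 : sec1 F;
  gs_glue : res0 gs0 = res1 gs1
}.

Definition globally_generated (A : comNzRingType) (F : p1sheaf A) : Prop :=
  (forall m : sec0 F, exists (s : nat) (c : 'I_s -> {poly A})
     (h : 'I_s -> global_section F), m = \sum_i c i *: gs0 (h i)) /\
  (forall m : sec1 F, exists (s : nat) (c : 'I_s -> {poly A})
     (h : 'I_s -> global_section F), m = \sum_i c i *: gs1 (h i)).

Definition vector_bundle (A : comNzRingType) (r : nat) (F : p1sheaf A) : Prop :=
  locally_free r (sec0 F) /\ locally_free r (sec1 F).

(* Morphisms F -> F' over the map of projective lines induced by f : A -> B,
   i.e. morphisms from F to the pushforward of F'. *)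
Record p1map (A B : comNzRingType) (f : {rmorphism A -> B})
    (F : p1sheaf A) (F' : p1sheaf B) := P1Map {
  map0 : sec0 F -> sec0 F';
  map1 : sec1 F -> sec1 F';
  map01 : sec01 F -> sec01 F';
  map0_semilinear : semilinear (map_poly f) map0;
  map1_semilinear : semilinear (map_poly f) map1;
  map01_semilinear : semilinear (map_poly f) map01;
  map_res0 : forall x, map01 (res0 x) = res0 (map0 x);
  map_res1 : forall x, map01 (res1 x) = res1 (map1 x)
}.

(* The condition on U01 follows by localization. *)
Definition is_pullback (A B : comNzRingType) (f : {rmorphism A -> B})
    (F : p1sheaf A) (F' : p1sheaf B) (u : p1map f F F') : Prop :=
  is_basechange (map_poly f) (map0 u) /\ is_basechange (map_poly f) (map1 u).

(* [F] is isomorphic to O(m), m = a - b: the frames e0 = x0^m on U0 and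
   e1 = x1^m on U1 are related by e1 = t^m e0, where t = x1 / x0. *)
Definition is_O (A : comNzRingType) (m : int) (F : p1sheaf A) : Prop :=
  exists (e0 : sec0 F) (e1 : sec1 F) (a b : nat),
    [/\ is_basis (fun _ : 'I_1 => e0), is_basis (fun _ : 'I_1 => e1),
        m = a%:Z - b%:Z & 'X^b *: res1 e1 = 'X^a *: res0 e0].

(* The degree of a rank r bundle over a field is that of its determinant.
   If e1 = t^(-N) G e0 is the change of frame, then det is glued by
   t^(-rN) det G = c t^d, hence is O(d).  Frames exist because K[t] is a
   principal ideal domain. *)
Definition has_degree (K : fieldType) (r : nat) (V : p1sheaf K) (d : int)
    : Prop :=
  exists (e0 : 'I_r -> sec0 V) (e1 : 'I_r -> sec1 V)
         (N : nat) (G : 'M[{poly K}]_r) (c : K) (n : nat),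
    [/\ is_basis e0, is_basis e1,
        forall i, 'X^N *: res1 (e1 i) = \sum_j G i j *: res0 (e0 j),
        c != 0 /\ \det G = c *: 'X^n
      & d = n%:Z - (r * N)%:Z].

(* [S] together with the multiplication maps is Sym^2 V (x) L; universality
   on U01 follows by localization. *)
Record sym2_twist (A : comNzRingType) (V L S : p1sheaf A) := Sym2Twist {
  mul0 : sec0 V -> sec0 V -> sec0 L -> sec0 S;
  mul1 : sec1 V -> sec1 V -> sec1 L -> sec1 S;
  mul01 : sec01 V -> sec01 V -> sec01 L -> sec01 S;
  mul0_univ : is_sym2_tensor mul0;
  mul1_univ : is_sym2_tensor mul1;
  mul01_trilinear : sym_trilinear mul01;
  mul_res0 : forall v w l,
    res0 (mul0 v w l) = mul01 (res0 v) (res0 w) (res0 l);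
  mul_res1 : forall v w l,
    res1 (mul1 v w l) = mul01 (res1 v) (res1 w) (res1 l)
}.

(** * Linear binary quadratic forms on the projective line *)

(* The model lSym of Sym^2 V (x) L is part of the data; it is unique up to
   unique isomorphism. *)
Record lbqf (A : comNzRingType) := Lbqf {
  lV : p1sheaf A;
  lL : p1sheaf A;
  lV_bundle : vector_bundle 2 lV;
  lL_bundle : vector_bundle 1 lL;
  lSym : p1sheaf A;
  lmul : sym2_twist lV lL lSym;
  lp : global_section lSym
}.

(* An isomorphism from the pullback of x along f : A -> B to y, i.e. a pair of
   isomorphisms between the pullbacks of V, L and V', L' carrying the pullback
   of p to p'; for f = id, an isomorphism x -> y. *)
Record lbqf_arrow (A B : comNzRingType) (f : {rmorphism A -> B})
    (x : lbqf A) (y : lbqf B) := LbqfArrow {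
  arV : p1map f (lV x) (lV y);
  arL : p1map f (lL x) (lL y);
  arV_pullback : is_pullback arV;
  arL_pullback : is_pullback arL;
  arS : p1map f (lSym x) (lSym y);
  arS_mul0 : forall v w l, map0 arS (mul0 (lmul x) v w l) =
    mul0 (lmul y) (map0 arV v) (map0 arV w) (map0 arL l);
  arS_mul1 : forall v w l, map1 arS (mul1 (lmul x) v w l) =
    mul1 (lmul y) (map1 arV v) (map1 arV w) (map1 arL l);
  ar_p0 : map0 arS (gs0 (lp x)) = gs0 (lp y);
  ar_p1 : map1 arS (gs1 (lp x)) = gs1 (lp y)
}.

(** * Algebras over the base field *)

Record kalg (k : fieldType) := KAlg {
  kring :> comNzRingType;
  kstr : {rmorphism k -> kring}
}.

Record kfield (k : fieldType) := KField {
  kfcar : fieldType;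
  kfstr : {rmorphism k -> kfcar}
}.

Definition kalg_of_kfield (k : fieldType) (K : kfield k) : kalg k :=
  @KAlg k (kfcar K) (kfstr K).
Coercion kalg_of_kfield : kfield >-> kalg.

Record khom (k : fieldType) (A B : kalg k) := KHom {
  kfun :> {rmorphism A -> B};
  khom_str : forall c : k, kfun (kstr A c) = kstr B c
}.

(** * Stacks and their topological spaces *)

(* The objects over each affine k-scheme Spec A and, for f : A -> B, the
   arrows from y over Spec B to x over Spec A lying over Spec f, that is, the
   isomorphisms between the pullback of x along f and y. *)
Record stack_data (k : fieldType) := StackData {
  ob : kalg k -> Type;
  arr : forall A B : kalg k, khom A B -> ob A -> ob B -> Type
}.

(* Functors from k-algebras to sets, in particular all k-schemes. *)
Record kspace (k : fieldType) := KSpace {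
  pt : kalg k -> Type;
  pmap : forall A B : kalg k, khom A B -> pt A -> pt B;
  pmap_id : forall (A : kalg k) (f : khom A A) (t : pt A),
    f =1 id -> pmap f t = t;
  pmap_comp : forall (A B C : kalg k)
      (f : khom A B) (g : khom B C) (h : khom A C) (t : pt A),
    h =1 g \o f -> pmap h t = pmap g (pmap f t)
}.

Definition stack_of_space (k : fieldType) (T : kspace k) : stack_data k :=
  {| ob := pt T;
     arr := fun A B (f : khom A B) (t : pt T A) (t' : pt T B) =>
              pmap f t = t' |}.

Definition stack_prod (k : fieldType) (X Y : stack_data k) : stack_data k :=
  {| ob := fun A => (ob X A * ob Y A)%type;
     arr := fun A B (f : khom A B) (z : ob X A * ob Y A)
                (z' : ob X B * ob Y B) =>
              (arr f z.1 z'.1 * arr f z.2 z'.2)%type |}.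

(* Points of |X| are objects over fields, up to the equivalence relation
   generated by isomorphism and extension of the field. *)
Inductive same_point (k : fieldType) (X : stack_data k) :
    forall K : kfield k, ob X K -> forall K' : kfield k, ob X K' -> Prop :=
| same_point_arr (K K' : kfield k) (f : khom K K') (x : ob X K) (y : ob X K') :
    arr f x y -> same_point x y
| same_point_refl (K : kfield k) (x : ob X K) : same_point x x
| same_point_sym (K K' : kfield k) (x : ob X K) (x' : ob X K') :
    same_point x x' -> same_point x' x
| same_point_trans (K K' K'' : kfield k)
    (x : ob X K) (x' : ob X K') (x'' : ob X K'') :
    same_point x x' -> same_point x' x'' -> same_point x x''.

Definition point_set (k : fieldType) (X : stack_data k) : Type :=
  forall K : kfield k, ob X K -> Prop.

Definition saturated (k : fieldType) (X : stack_data k) (W : point_set X)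
    : Prop :=
  forall (K : kfield k) (x : ob X K) (K' : kfield k) (x' : ob X K'),
    same_point x x' -> W K x -> W K' x'.

(* A subset of |X| is closed when its preimage under every Spec A -> X is
   Zariski closed, i.e. of the form V(I).  For an algebraic stack (or a scheme)
   X this is the usual topology of |X|, since Spec A may range over the charts
   of a smooth atlas. *)
Definition closed_subset (k : fieldType) (X : stack_data k) (W : point_set X)
    : Prop :=
  saturated W /\
  forall (A : kalg k) (xi : ob X A), exists I : A -> Prop,
    forall (K : kfield k) (phi : khom A K) (x : ob X K),
      inhabited (arr phi xi x) ->
      (W K x <-> forall a : A, I a -> phi a = 0).

(* The image of W under the projection |X x Y| -> |X|. *)
Definition proj_image (k : fieldType) (X Y : stack_data k)
    (W : point_set (stack_prod X Y)) : point_set X :=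
  fun K x => exists (K' : kfield k) (z : ob (stack_prod X Y) K'),
    W K' z /\ same_point z.1 x.

(* |T x X| -> |T| is closed for every T over Spec k. *)
Definition universally_closed (k : fieldType) (X : stack_data k) : Prop :=
  forall (T : kspace k) (W : point_set (stack_prod (stack_of_space T) X)),
    closed_subset W -> closed_subset (proj_image W).

(** * The stacks of linear binary quadratic forms *)

Definition in_J (k : fieldType) (g n : int) (A : kalg k) (x : lbqf A) : Prop :=
  forall (K : kfield k) (phi : khom A K) (V' L' : p1sheaf (kfcar K))
         (u : p1map phi (lV x) V') (v : p1map phi (lL x) L'),
    is_pullback u -> is_pullback v ->
    exists dV dL : int,
      [/\ has_degree 2 V' dV, has_degree 1 L' dL,
          dV + dL - 1 = g & 2 * dV + dL = n].

(* The open condition "Sym^2 V (x) O(m) is globally generated", which is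
   imposed on the fibers of V over the points of Spec A. *)
Definition bd_bundle (k : fieldType) (m : int) (A : kalg k) (V : p1sheaf A)
    : Prop :=
  forall (K : kfield k) (phi : khom A K) (V' : p1sheaf (kfcar K))
         (u : p1map phi V V'),
    is_pullback u ->
    forall O S : p1sheaf (kfcar K),
      is_O m O -> sym2_twist V' O S -> globally_generated S.

Definition Jbar (k : fieldType) (g n : int) : stack_data k :=
  {| ob := fun A => {x : lbqf A | in_J g n x};
     arr := fun A B (f : khom A B) x y =>
              lbqf_arrow f (proj1_sig x) (proj1_sig y) |}.

Definition Jbar_bd (k : fieldType) (g n : int) : stack_data k :=
  {| ob := fun A => {x : ob (Jbar k g n) A |
                       bd_bundle (2 * g - n + 2) (lV (proj1_sig x))};
     arr := fun A B (f : khom A B) x y => arr f (proj1_sig x) (proj1_sig y) |}.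

(* Main.v *)
(** A form [x = (V, L, p)] over a field is a generic member of a family whose
    special member [x0] does not depend on [x]: Grothendieck's theorem and global
    generation give V = O(c) + O(d - c) with c and d - c at least i0, the least
    integer with 2 i0 + k >= 0; hence V is an extension of O(d - i0) by O(i0).
    Scaling the extension class and [L] by a parameter [u] moves p along, and at
    u = 0 leaves x0 = (O(d - i0) + O(i0), O(k), 0).  So every closed subset of
    |T x J_bd| which contains (t, x) contains (t, x0), and its image in |T| is the
    closed set of all t such that it contains (t, x0). *)

From HB Require Import structures.
From mathcomp Require Import all_boot all_order all_algebra ring zify.
Require Import Defs.

Set Implicit Arguments.
Unset Strict Implicit.
Unset Printing Implicit Defensive.

Import GRing.Theory.
Local Open Scope ring_scope.

(** V is such an extension because V(-i0) = O(c - i0) + O(d - c - i0) has summands of nonnegative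
    degree: a power of x0 and a power of x1 have no common zero and form a nowhere vanishing
    section. The extension class is then a single monomial, so that only one exponent [ga] depends
    on x, and at u = 0 this exponent is lost. For u invertible the bundle is V again, at u = 0 it is
    O(i0) + O(d - i0); no summand is ever below i0, and the family stays inside J_bd. The map
    diag(1, u) of V multiplies the class by u, but alone it would leave the coefficient of p at the
    square of the first frame vector; this is why L is scaled too. Scaling by u is invertible over
    K(u) only. So x is compared with the generic member over K(u), whereas over K[u] the same
    formulas merely transport p. Closedness is tested on objects over rings such as K[u], so the
    family has to be an actual object there. Hence sheaves are glued from explicit matrices, while
    pullbacks and Sym^2 V (x) L, known only by universal properties, are reached through frames. *)

(** * Laurent polynomials *)

Section Laurent.
Local Open Scope quotient_scope.
Variable A : comNzRingType.
Local Notation pre := ({poly A} * nat)%type.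
Implicit Types x y z : pre.

Lemma polyXn_lreg n : GRing.lreg ('X^n : {poly A}).
Proof. by apply/monic_lreg/monicXn. Qed.

(** The pair (p, n) stands for p / X^n. The base ring may have zero divisors; cross-multiplication
    is still transitive because X is regular over every ring. *)
Definition leqv x y := 'X^(y.2) * x.1 == 'X^(x.2) * y.1.

Lemma leqv_refl : reflexive leqv. Proof. by move=> x; rewrite /leqv. Qed.

Lemma leqv_sym : symmetric leqv.
Proof. by move=> x y; rewrite /leqv eq_sym. Qed.

Lemma leqv_trans : transitive leqv.
Proof.
move=> [q m] [p n] [r l]; rewrite /leqv /= => /eqP pq /eqP qr; apply/eqP.
by apply: (@polyXn_lreg m); rewrite mulrCA pq mulrCA qr mulrCA.
Qed.

Canonical leqv_equiv := EquivRel leqv leqv_refl leqv_sym leqv_trans.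

Definition laurent := {eq_quot leqv}.
HB.instance Definition _ : EqQuotient _ leqv laurent := EqQuotient.on laurent.
HB.instance Definition _ := Choice.on laurent.

Lemma leqv_repr x : 'X^((repr (\pi_laurent x)).2) * x.1 =
                    'X^(x.2) * (repr (\pi_laurent x)).1.
Proof.
by apply/eqP; rewrite -/(leqv x (repr (\pi_laurent x))) -(eqmodE leqv_equiv) reprK.
Qed.

Definition lembed (p : {poly A}) : laurent := \pi_laurent (p, 0%N).
Definition linvX : laurent := \pi_laurent (1, 1%N).

Definition laddf x y : pre := ('X^(y.2) * x.1 + 'X^(x.2) * y.1, (x.2 + y.2)%N).
Definition ladd := lift_op2 laurent laddf.

Lemma pi_ladd : {morph \pi : x y / laddf x y >-> ladd x y}.
Proof.
move=> x y; unlock ladd; apply/eqmodP; rewrite /= /leqv /laddf /=; apply/eqP.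
move: (leqv_repr x) (leqv_repr y); rewrite !exprD.
set a := repr (\pi_laurent x); set b := repr (\pi_laurent y); clearbody a b.
move: ('X^(a.2)) ('X^(b.2)) ('X^(x.2)) ('X^(y.2)) => p q r s ex ey.
transitivity (q * s * (p * x.1) + p * r * (q * y.1)); first by ring.
by rewrite ex ey; ring.
Qed.
Canonical pi_ladd_morph := PiMorph2 pi_ladd.

Definition loppf x : pre := (- x.1, x.2).
Definition lopp := lift_op1 laurent loppf.

Lemma pi_lopp : {morph \pi : x / loppf x >-> lopp x}.
Proof.
move=> x; unlock lopp; apply/eqmodP; rewrite /= /leqv /loppf /=.
by rewrite !mulrN leqv_repr.
Qed.
Canonical pi_lopp_morph := PiMorph1 pi_lopp.

Definition lmulf x y : pre := (x.1 * y.1, (x.2 + y.2)%N).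
Definition lmult := lift_op2 laurent lmulf.

Lemma pi_lmul : {morph \pi : x y / lmulf x y >-> lmult x y}.
Proof.
move=> x y; unlock lmult; apply/eqmodP; rewrite /= /leqv /lmulf /=; apply/eqP.
by rewrite !exprD mulrACA !leqv_repr mulrACA.
Qed.
Canonical pi_lmul_morph := PiMorph2 pi_lmul.

Lemma laddA : associative ladd.
Proof.
elim/quotW=> x; elim/quotW=> y; elim/quotW=> z; apply/eqP; rewrite !piE.
by apply/eqP; rewrite /leqv /laddf /= !exprD; ring.
Qed.

Lemma laddC : commutative ladd.
Proof.
elim/quotW=> x; elim/quotW=> y; apply/eqP; rewrite !piE /=.
by apply/eqP; rewrite /laddf /= !exprD; ring.
Qed.

Lemma ladd0 : left_id (lembed 0) ladd.
Proof.
by elim/quotW=> x; apply/eqP; rewrite !piE; apply/eqP; rewrite /laddf /=; ring.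
Qed.

Lemma laddN : left_inverse (lembed 0) lopp ladd.
Proof.
by elim/quotW=> x; apply/eqP; rewrite !piE; apply/eqP; rewrite /laddf /=; ring.
Qed.

HB.instance Definition _ := GRing.isZmodule.Build laurent laddA laddC ladd0 laddN.

Lemma lmulA : associative lmult.
Proof.
elim/quotW=> x; elim/quotW=> y; elim/quotW=> z; apply/eqP; rewrite !piE.
by apply/eqP; rewrite /lmulf /= !exprD; ring.
Qed.

Lemma lmulC : commutative lmult.
Proof.
elim/quotW=> x; elim/quotW=> y; apply/eqP; rewrite !piE /=.
by apply/eqP; rewrite /lmulf /= !exprD; ring.
Qed.

Lemma lmul1 : left_id (lembed 1) lmult.
Proof.
by elim/quotW=> x; apply/eqP; rewrite !piE; apply/eqP; rewrite /lmulf /=; ring.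
Qed.

Lemma lmulDl : left_distributive lmult ladd.
Proof.
elim/quotW=> x; elim/quotW=> y; elim/quotW=> z; apply/eqP; rewrite !piE.
by apply/eqP; rewrite /lmulf /laddf /= !exprD; ring.
Qed.

Lemma lembed_inj : injective lembed.
Proof. by move=> p q /eqmodP /eqP; rewrite /= !expr0 !mul1r. Qed.

Lemma lone_neq0 : lembed 1 != lembed 0.
Proof. by rewrite (inj_eq lembed_inj) oner_neq0. Qed.

HB.instance Definition _ := GRing.Zmodule_isComNzRing.Build laurent
  lmulA lmulC lmul1 lmulDl lone_neq0.

Lemma lembed_zmod_morphism : zmod_morphism lembed.
Proof.
move=> p q; apply/eqP; change (lembed (p - q) == ladd (lembed p) (lopp (lembed q))).
by rewrite !piE; apply/eqP; rewrite /laddf /=; ring.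
Qed.
HB.instance Definition _ :=
  GRing.isZmodMorphism.Build {poly A} laurent lembed lembed_zmod_morphism.

Lemma lembed_monoid_morphism : monoid_morphism lembed.
Proof.
split=> // p q; apply/eqP.
by change (lembed (p * q) == lmult (lembed p) (lembed q)); rewrite !piE.
Qed.
HB.instance Definition _ :=
  GRing.isMonoidMorphism.Build {poly A} laurent lembed lembed_monoid_morphism.

Lemma linvXl : linvX * lembed 'X = 1.
Proof.
apply/eqP; change (lmult linvX (lembed 'X) == lembed 1); rewrite !piE /=.
by rewrite /leqv /lmulf /=; apply/eqP; ring.
Qed.

Lemma lembed_onto (y : laurent) : exists n p, lembed 'X ^+ n * y = lembed p.
Proof.
elim/quotW: y => -[p n]; exists n, p; rewrite -rmorphXn; apply/eqP.
change (lmult (lembed 'X^n) (\pi_laurent (p, n)) == lembed p); rewrite !piE /=.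
by rewrite /leqv /lmulf /=; apply/eqP; ring.
Qed.

End Laurent.

(** * The reversal t^D p(1/t) of a polynomial *)

Section PolyReverse.
Variable A : comNzRingType.
Implicit Types p : {poly A}.

Definition revp D p := \poly_(j < D.+1) p`_(D - j).

Lemma poly_sum_bound D p : (size p <= D.+1)%N -> p = \sum_(i < D.+1) p`_i *: 'X^i.
Proof.
move=> sp; apply/polyP => j; rewrite -(poly_def D.+1 (fun i => p`_i)) coef_poly.
by case: ltnP => // /(leq_trans sp) /(nth_default _).
Qed.

Lemma size_revp D p : (size (revp D p) <= D.+1)%N.
Proof. exact: size_poly. Qed.

Lemma revpK D p : (size p <= D.+1)%N -> revp D (revp D p) = p.
Proof.
move=> sp; apply/polyP => i; rewrite !coef_poly; case: ltnP => iD.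
  by rewrite ltnS leq_subr subKn.
by rewrite nth_default // (leq_trans sp).
Qed.

Lemma revpE D p : revp D p = \sum_(i < D.+1) p`_i *: 'X^(D - i).
Proof.
rewrite /revp poly_def (reindex_inj rev_ord_inj) /=; apply: eq_bigr => i _.
by rewrite subSS subKn // -ltnS.
Qed.

End PolyReverse.

(** * The ring A[t,1/t] seen from U1 *)

Section LaurentInverse.
Variable A : comNzRingType.
Local Notation L := (laurent A).
Local Notation pos := (@lembed A).
Implicit Types p : {poly A}.

Lemma lpol_comm : commr_rmorph (pos \o polyC) (linvX A).
Proof. by move=> a; rewrite /GRing.comm mulrC. Qed.

(** Restriction of functions from U1 to U01, where s becomes 1/t; [lembed] plays this role for
    U0. *)
Definition lneg : {poly A} -> L := horner_morph lpol_comm.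
HB.instance Definition _ := GRing.RMorphism.on lneg.

Lemma lnegX : lneg 'X = linvX A. Proof. exact: horner_morphX. Qed.

Lemma lnegC (a : A) : lneg a%:P = pos a%:P.
Proof. exact: horner_morphC. Qed.

Lemma lposnegXn n : pos 'X^n * lneg 'X^n = 1.
Proof. by rewrite !rmorphXn -exprMn mulrC /= lnegX linvXl expr1n. Qed.

Lemma lpos_neg D p : (size p <= D.+1)%N -> pos 'X^D * lneg p = pos (revp D p).
Proof.
move=> sp; rewrite revpE.
rewrite {1}(poly_sum_bound sp).
rewrite !rmorph_sum mulr_sumr; apply: eq_bigr => i _.
rewrite -!mul_polyC !rmorphM.
rewrite /= lnegC mulrCA; congr (_ * _).
by rewrite -{1}(subnK (ltn_ord i : i <= D)%N) exprD rmorphM -mulrA lposnegXn mulr1.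
Qed.

Lemma lposXn_inj n (x y : L) : pos 'X^n * x = pos 'X^n * y -> x = y.
Proof.
by move/(congr1 (fun z => lneg 'X^n * z)); rewrite !mulrA ![lneg _ * _]mulrC
  lposnegXn !mul1r.
Qed.

Lemma lneg_eq0 p : lneg p = 0 -> p = 0.
Proof.
move=> p0; have sp : (size p <= (size p).+1)%N by [].
have := lpos_neg sp; rewrite p0 mulr0 => /esym/eqP.
rewrite -(rmorph0 pos) (inj_eq (@lembed_inj A)) => /eqP e.
by rewrite -(revpK sp) e /revp; apply/polyP => i; rewrite coef_poly !coef0 if_same.
Qed.

Lemma lneg_onto (y : L) : exists n p, y = pos 'X^n * lneg p.
Proof.
have [n [p e]] := lembed_onto y.
have sp : (size p <= (size p).+1)%N by [].
(* Here y = t^-n p and p = t^D q(1/t), with q the reversal of p for D = [size p]; the factor t^-n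
   enters the argument of [lneg] as X^n. *)
exists (size p), ('X^n * revp (size p) p); apply: (@lposXn_inj n).
rewrite rmorphM /= [RHS]mulrCA (mulrA (pos _) (lneg _)) lposnegXn mul1r.
by rewrite lpos_neg ?revpK ?size_revp // rmorphXn.
Qed.

End LaurentInverse.

(** * Bases and base change *)

Section Semilinear.
Variables (R R' : nzRingType) (phi : {rmorphism R -> R'}).
Variables (M : lmodType R) (N : lmodType R') (u : M -> N).
Hypothesis ul : semilinear phi u.

Lemma semilinearD x y : u (x + y) = u x + u y.
Proof. by have := ul 1 x y; rewrite rmorph1 !scale1r. Qed.

Lemma semilinear0 : u 0 = 0.
Proof. by apply: (addrI (u 0)); rewrite -semilinearD !addr0. Qed.

Lemma semilinearZ a x : u (a *: x) = phi a *: u x.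
Proof. by have := ul a x 0; rewrite semilinear0 !addr0. Qed.

Lemma semilinearB x y : u (x - y) = u x - u y.
Proof.
by have := ul (- 1) y x; rewrite rmorphN1 !scaleN1r ![- _ + _]addrC.
Qed.

Lemma semilinear_sum (I : Type) (s : seq I) (x : I -> M) :
  u (\sum_(i <- s) x i) = \sum_(i <- s) u (x i).
Proof. exact: (big_morph u semilinearD semilinear0). Qed.

End Semilinear.

Section SemilinearComp.
Variables (R R' R'' : nzRingType).

Lemma semilinear_linear (M N : lmodType R) (h : {linear M -> N}) :
  semilinear idfun h.
Proof. by move=> a x y; rewrite linearP. Qed.

Lemma semilinear_comp (phi : R -> R') (psi : R' -> R'') (chi : R -> R'')
    (M : lmodType R) (N : lmodType R') (P : lmodType R'') (u : M -> N) (v : N -> P) :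
  semilinear phi u -> semilinear psi v -> chi =1 psi \o phi ->
  semilinear chi (v \o u).
Proof. by move=> ul vl e a x y; rewrite /= ul vl e. Qed.

Section Pack.
Variables (M N : lmodType R) (h : M -> N).

Definition linear_of of semilinear idfun h := h.
Hypothesis hl : semilinear idfun h.
Local Notation hh := (linear_of hl).

Fact linear_of_is_linear : linear hh. Proof. exact: hl. Qed.
HB.instance Definition _ := GRing.isLinear.Build R M N *:%R hh linear_of_is_linear.

Lemma ex_linear : exists h' : {linear M -> N}, h' =1 h.
Proof. by exists hh. Qed.

End Pack.
End SemilinearComp.

Section Bases.
Variables (R : nzRingType) (M : lmodType R) (r : nat) (e : 'I_r -> M).
Hypothesis eb : is_basis e.

Lemma basis_inj c c' : \sum_i c i *: e i = \sum_i c' i *: e i -> c =1 c'.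
Proof.
move=> cc' i; apply/eqP; rewrite -subr_eq0; apply/eqP.
apply: (eb.2 (fun i => c i - c' i)); under eq_bigr do rewrite scalerBl.
by rewrite sumrB cc' subrr.
Qed.

Lemma basis_coord : exists co : M -> 'I_r -> R, forall m, m = \sum_i co m i *: e i.
Proof.
(* Row vectors rather than functions, since [xchoose] picks from a [choiceType]. *)
have ex m : exists c : 'rV[R]_r, m == \sum_i c 0 i *: e i.
  have [c ->] := eb.1 m; exists (\row_i c i); apply/eqP.
  by apply: eq_bigr => i _; rewrite mxE.
by exists (fun m i => xchoose (ex m) 0 i) => m; apply/eqP/(xchooseP (ex m)).
Qed.

Lemma basis_lift (R' : nzRingType) (phi : {rmorphism R -> R'})
    (N : lmodType R') (x : 'I_r -> N) :
  exists h : M -> N, semilinear phi h /\ forall i, h (e i) = x i.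
Proof.
have [co coE] := basis_coord; exists (fun m => \sum_i phi (co m i) *: x i); split.
  move=> a m m'; rewrite scaler_sumr -big_split /=; apply: eq_bigr => i _.
  rewrite scalerA -rmorphM -scalerDl -rmorphD; congr (phi _ *: _).
  apply: (@basis_inj _ (fun i => a * co m i + co m' i)).
  rewrite -coE {1}(coE m) {1}(coE m') scaler_sumr -big_split.
  by apply: eq_bigr => j _; rewrite scalerDl scalerA.
move=> i; rewrite (bigD1 i) //= big1 => [|j ji].
  rewrite (@basis_inj _ (fun j => (j == i)%:R)) ?eqxx ?rmorph1 ?scale1r ?addr0 //.
  rewrite -coE (bigD1 i) //= eqxx scale1r big1 ?addr0 // => j /negPf ->.
  by rewrite scale0r.
rewrite (@basis_inj _ (fun j => (j == i)%:R)) ?(negPf ji) ?rmorph0 ?scale0r //.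
rewrite -coE (bigD1 i) //= eqxx scale1r big1 ?addr0 // => l /negPf ->.
by rewrite scale0r.
Qed.

Lemma basis_ext (R' : nzRingType) (phi : {rmorphism R -> R'}) (N : lmodType R')
    (u v : M -> N) : semilinear phi u -> semilinear phi v ->
  (forall i, u (e i) = v (e i)) -> u =1 v.
Proof.
move=> ul vl uv m; have [c ->] := eb.1 m.
rewrite (semilinear_sum ul) (semilinear_sum vl); apply: eq_bigr => i _.
by rewrite (semilinearZ ul) (semilinearZ vl) uv.
Qed.

End Bases.

Lemma basechange_of_basis (R R' : nzRingType) (phi : {rmorphism R -> R'})
    (M : lmodType R) (M' : lmodType R') (r : nat) (e : 'I_r -> M) (u : M -> M') :
  is_basis e -> semilinear phi u -> is_basis (u \o e) -> is_basechange phi u.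
Proof.
move=> eb ul ub; split=> // N v vl; split; last first.
  move=> h h' hh'; apply: (basis_ext ub (semilinear_linear h) (semilinear_linear h')).
  by move=> i; apply: hh'.
have [h [hl hE]] := basis_lift ub idfun (fun i => v (e i)).
have [h' h'E] := ex_linear hl; exists h' => x.
have hul : semilinear phi (h \o u) by apply: (semilinear_comp ul hl).
by rewrite h'E; apply: (basis_ext eb hul vl hE).
Qed.

Lemma basis_delta (R : nzRingType) r :
  is_basis (fun i : 'I_r => delta_mx 0 i : 'rV[R]_r).
Proof.
split=> [m|c c0 i]; first by exists (m 0); rewrite [LHS]row_sum_delta.
have := congr1 (fun m : 'rV_r => m 0 i) c0; rewrite summxE mxE (bigD1 i) //=.
rewrite !mxE !eqxx mulr1 big1 ?addr0 // => j ji.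
by rewrite !mxE eqxx eq_sym (negPf ji) mulr0.
Qed.

(** The universal property gives [h] from [M'] to row vectors. Uniqueness makes the obvious map [g]
    back a left inverse, so the images span; applying [h] to a relation shows that they are
    independent. *)
Lemma basechange_basis (R R' : nzRingType) (phi : {rmorphism R -> R'})
    (M : lmodType R) (M' : lmodType R') (r : nat) (e : 'I_r -> M) (u : M -> M') :
  is_basis e -> is_basechange phi u -> is_basis (u \o e).
Proof.
move=> eb [ul uP].
have [v [vl vE]] := basis_lift eb phi (fun i => delta_mx 0 i : 'rV[R']_r).
have [[h hE] _] := uP _ v vl; have [_ uniq] := uP M' u ul.
have [g [gl gE]] := basis_lift (basis_delta R' r) idfun (u \o e).
have [g' g'E] := ex_linear gl.
have gh : forall m, g (h m) = m.
  move=> m; rewrite -g'E; apply: (uniq (g' \o h) idfun) => x /=; rewrite hE g'E.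
  have gvl : semilinear phi (g \o v) by apply: (semilinear_comp vl gl).
  by apply: (basis_ext eb gvl ul) => i /=; rewrite vE gE.
split=> [m|c c0].
  exists (h m 0); rewrite -{1}(gh m) {1}[h m]row_sum_delta (semilinear_sum gl).
  by apply: eq_bigr => i _; rewrite (semilinearZ gl) gE.
apply: (basis_delta R' r).2; transitivity (h 0); last exact: linear0.
by rewrite -c0 linear_sum; apply: eq_bigr => i _; rewrite linearZ /= hE vE.
Qed.

Lemma scalerCA (R : comNzRingType) (M : lmodType R) p q (y : M) :
  p *: (q *: y) = q *: (p *: y).
Proof. by rewrite !scalerA mulrC. Qed.

Section BasisChange.
Variables (R : comNzRingType) (M : lmodType R) (r : nat).

Lemma basis_mx (e : 'I_r -> M) (P Q : 'M[R]_r) : is_basis e ->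
  P *m Q = 1%:M -> Q *m P = 1%:M -> is_basis (fun i => \sum_j P i j *: e j).
Proof.
move=> eb PQ QP.
have sumE c (B : 'M[R]_r) : \sum_i c i *: (\sum_j B i j *: e j) =
    \sum_j ((\row_i c i) *m B) 0 j *: e j.
  under eq_bigr do rewrite scaler_sumr; rewrite exchange_big /=.
  apply: eq_bigr => j _; rewrite mxE scaler_suml.
  by apply: eq_bigr => i _; rewrite mxE scalerA.
split=> [m|c].
  have [c ->] := eb.1 m; exists (((\row_i c i) *m Q) 0).
  rewrite sumE; apply: eq_bigr => j _.
  rewrite (_ : \row_i _ = \row_i c i *m Q); last by apply/rowP => i; rewrite mxE.
  by rewrite -mulmxA QP mulmx1 mxE.
rewrite sumE => /(eb.2 _) c0 i.
have : (\row_i c i) *m P *m Q = 0.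
  by rewrite (_ : _ *m P = 0) ?mul0mx //; apply/rowP => j; rewrite c0 mxE.
by rewrite -mulmxA PQ mulmx1 => /(congr1 (fun m : 'rV_r => m 0 i)); rewrite !mxE.
Qed.

Lemma basis_locally_free (e : 'I_r -> M) : is_basis e -> locally_free r M.
Proof.
move=> eb; exists 1%N, (fun=> 1), (fun=> 1); split=> [|_].
  by rewrite big_ord1 mulr1.
exists e; split=> [m|c c0].
  by have [c ->] := eb.1 m; exists 0%N, c; rewrite expr0 scale1r.
by exists 0%N => i; rewrite expr0 mul1r (eb.2 _ c0).
Qed.

End BasisChange.

(** * Sheaves on the projective line *)

Section SheafTheory.
Variables (A : comNzRingType) (F : p1sheaf A).

Lemma sec01_Xn_inj n : injective (fun y : sec01 F => 'X^n *: y).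
Proof.
elim: n => [|n IH] y y'; first by rewrite expr0 !scale1r.
rewrite exprS -!scalerA => e; apply: IH; exact: (bij_inj (sec01_bij F) e).
Qed.

Lemma sec01_Xn_surj n (y : sec01 F) : exists z, 'X^n *: z = y.
Proof.
elim: n y => [|n IH] y; first by exists y; rewrite expr0 scale1r.
have [g _ gK] := sec01_bij F; have [z e] := IH (g y).
by exists z; rewrite exprS -scalerA e gK.
Qed.

Lemma res0_semilinear : semilinear (@idfun {poly A}) (@res0 A F).
Proof. exact: res0_linear. Qed.

End SheafTheory.

(* A change of base along [f] which inverts the variable, like the restriction
   of the sections on U1 to U01. *)
Section Twisted.
Variables (A B : comNzRingType) (f : {rmorphism A -> B}) (G : p1sheaf B).
Variable M : lmodType {poly A}.

Definition twisted (u : M -> sec01 G) : Prop :=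
  (forall a x y, u (a%:P *: x + y) = (f a)%:P *: u x + u y) /\
  (forall x, 'X *: u ('X *: x) = u x).

Section Theory.
Variables (u : M -> sec01 G) (ut : twisted u).

Lemma twistedD x y : u (x + y) = u x + u y.
Proof.
have := ut.1 1 x y.
by rewrite !rmorph1 !scale1r.
Qed.

Lemma twisted0 : u 0 = 0.
Proof. by apply: (addrI (u 0)); rewrite -twistedD !addr0. Qed.

Lemma twistedC a x : u (a%:P *: x) = (f a)%:P *: u x.
Proof. by have := ut.1 a x 0; rewrite twisted0 !addr0. Qed.

Lemma twisted_sum (I : Type) (s : seq I) (x : I -> M) :
  u (\sum_(i <- s) x i) = \sum_(i <- s) u (x i).
Proof. exact: (big_morph u twistedD twisted0). Qed.

Lemma twistedXn n x : 'X^n *: u ('X^n *: x) = u x.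
Proof.
elim: n x => [|n IH] x; first by rewrite expr0 !scale1r.
by rewrite {1}exprSr exprS -!scalerA ut.2 IH.
Qed.

(** A polynomial p in s acts on U01 as p(1/t), which need not lie in A[t]; the factor t^D clears the
    denominators and leaves the reversal. *)
Lemma twistedZ D (p : {poly A}) (x : M) : (size p <= D.+1)%N ->
  'X^D *: u (p *: x) = revp D (map_poly f p) *: u x.
Proof.
move=> sp; rewrite revpE.
rewrite {1}(poly_sum_bound sp).
under [in LHS]eq_bigr do rewrite -mul_polyC.
rewrite !scaler_suml twisted_sum scaler_sumr; apply: eq_bigr => i _.
rewrite -scalerA twistedC coef_map /= -mul_polyC scalerA mulrC -!scalerA.
congr (_ *: _).
by rewrite -{1}(subnK (ltn_ord i : i <= D)%N) exprD -scalerA twistedXn.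
Qed.

End Theory.

Lemma twisted_basis_ext r (e : 'I_r -> M) u v : is_basis e ->
  twisted u -> twisted v -> (forall i, u (e i) = v (e i)) -> u =1 v.
Proof.
move=> eb ut vt uv m; have [c ->] := eb.1 m.
rewrite (twisted_sum ut) (twisted_sum vt); apply: eq_bigr => i _.
apply: (@sec01_Xn_inj _ G (size (c i))).
by rewrite /= (twistedZ ut) ?(twistedZ vt) ?uv.
Qed.

End Twisted.

Lemma res1_twisted (A : comNzRingType) (F : p1sheaf A) :
  twisted (@idfun A) (@res1 A F).
Proof. by split; [exact: res1_Alinear | exact: res1_X]. Qed.

Lemma res1Z (A : comNzRingType) (F : p1sheaf A) D (p : {poly A}) (x : sec1 F) :
  (size p <= D.+1)%N -> 'X^D *: res1 (p *: x) = revp D p *: res1 x.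
Proof.
by move=> sp; rewrite (twistedZ (res1_twisted F) _ sp) map_poly_id.
Qed.

Section Restrictions.
Variables (A : comNzRingType) (F : p1sheaf A).

Lemma res1D (x y : sec1 F) : res1 (x + y) = res1 x + res1 y.
Proof. exact: (twistedD (res1_twisted F)). Qed.

Lemma res1_0 : res1 (0 : sec1 F) = 0.
Proof. exact: (twisted0 (res1_twisted F)). Qed.

Lemma res1N (x : sec1 F) : res1 (- x) = - res1 x.
Proof. by apply: (addrI (res1 x)); rewrite -res1D !subrr res1_0. Qed.

Lemma res1B (x y : sec1 F) : res1 (x - y) = res1 x - res1 y.
Proof. by rewrite res1D res1N. Qed.

Lemma res1C a (x : sec1 F) : res1 (a%:P *: x) = a%:P *: res1 x.
Proof. exact: (twistedC (res1_twisted F)). Qed.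

Lemma res1Xn n (x : sec1 F) : 'X^n *: res1 ('X^n *: x) = res1 x.
Proof. exact: (twistedXn (res1_twisted F)). Qed.

Lemma res0_0 : res0 (0 : sec0 F) = 0.
Proof. exact: (semilinear0 (@res0_semilinear A F)). Qed.

Lemma res0B (x y : sec0 F) : res0 (x - y) = res0 x - res0 y.
Proof. exact: (semilinearB (@res0_semilinear A F)). Qed.

Lemma res0Z p (x : sec0 F) : res0 (p *: x) = p *: res0 x.
Proof. exact: (semilinearZ (@res0_semilinear A F)). Qed.

Lemma res0_sum (I : Type) (s : seq I) (x : I -> sec0 F) :
  res0 (\sum_(i <- s) x i) = \sum_(i <- s) res0 (x i).
Proof. exact: (semilinear_sum (@res0_semilinear A F)). Qed.

End Restrictions.

(** * Localizing a map on U0 to U01 *)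

Section LocalizedMap.
Variables (A B : comNzRingType) (f : {rmorphism A -> B}).
Variables (F : p1sheaf A) (G : p1sheaf B) (u : sec0 F -> sec0 G).
Hypothesis ul : semilinear (map_poly f) u.

(** The graph of the localization of [u]: x / t^n is related to u(x) / t^n. *)
Let related (y : sec01 F) (z : sec01 G) :=
  exists n x, 'X^n *: y = res0 x /\ 'X^n *: z = res0 (u x).

Lemma related_fun y z z' : related y z -> related y z' -> z = z'.
Proof.
have r0 (C : comNzRingType) (H : p1sheaf C) : semilinear idfun (@res0 C H) := @res0_semilinear C H.
move=> [n [x [yx zx]]] [m [x' [yx' zx']]].
(* The kernel of [res0] is t-torsion, so the cross-multiplied representatives agree on U0 up to a
   power of t, and [u] preserves this. *)
have [l e] : exists l, 'X^l *: ('X^m *: x - 'X^n *: x') = 0.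
  apply: res0_ker; rewrite (semilinearB (r0 _ _)) !(semilinearZ (r0 _ _)) /=.
  by rewrite -yx -yx' !scalerA mulrC subrr.
have {}e : 'X^l *: ('X^m *: u x - 'X^n *: u x') = 0.
  have := congr1 u e; rewrite (semilinear0 ul) (semilinearZ ul) (semilinearB ul).
  by rewrite !(semilinearZ ul) !rmorphXn /= map_polyX.
apply: (@sec01_Xn_inj _ G (l + (m + n))); apply/eqP; rewrite /= -subr_eq0.
have := congr1 (@res0 _ G) e.
rewrite (semilinear0 (r0 _ _)) (semilinearZ (r0 _ _)) (semilinearB (r0 _ _)).
rewrite !(semilinearZ (r0 _ _)) /= -zx -zx' !scalerA -!exprD => <-.
by rewrite scalerBr !scalerA -!exprD (addnC n m).
Qed.

Lemma related_semilinear p y z y' z' : related y z -> related y' z' ->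
  related (p *: y + y') (map_poly f p *: z + z').
Proof.
have r0 (C : comNzRingType) (H : p1sheaf C) : semilinear idfun (@res0 C H) := @res0_semilinear C H.
move=> [n [x [yx zx]]] [m [x' [yx' zx']]].
exists (m + n)%N, (('X^m * p) *: x + 'X^n *: x'); split.
  rewrite (r0 _ _ _) (semilinearZ (r0 _ _)) -yx -yx' scalerDr !scalerA /=.
  by congr (_ *: _ + _ *: _); rewrite exprD; ring.
rewrite ul (r0 _ _ _) !(semilinearZ ul) !(semilinearZ (r0 _ _)) -zx -zx'.
rewrite scalerDr !scalerA rmorphM !rmorphXn /= map_polyX.
by congr (_ *: _ + _ *: _); rewrite exprD; ring.
Qed.

Lemma related_res0 x : related (res0 x) (res0 (u x)).
Proof. by exists 0%N, x; rewrite expr0 !scale1r. Qed.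

Lemma localized_map : exists u01 : sec01 F -> sec01 G,
  semilinear (map_poly f) u01 /\ forall x, u01 (res0 x) = res0 (u x).
Proof.
have ex y : exists w : nat * sec0 F * sec01 G,
    ('X^(w.1.1) *: y == res0 w.1.2) && ('X^(w.1.1) *: w.2 == res0 (u w.1.2)).
  have [n [x yx]] := res0_onto y; have [z zx] := sec01_Xn_surj n (res0 (u x)).
  by exists (n, x, z); rewrite yx zx !eqxx.
pose v y := (xchoose (ex y)).2.
have vP y : related y (v y).
  have /andP[/eqP yx /eqP zx] := xchooseP (ex y).
  by exists (xchoose (ex y)).1.1, (xchoose (ex y)).1.2.
exists v; split=> [p y y'|x].
  by apply: (related_fun (vP _)); apply: related_semilinear.
by apply: (related_fun (vP _)); apply: related_res0.
Qed.

End LocalizedMap.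

Section TwistedComp.
Variables (A B : comNzRingType) (f : {rmorphism A -> B}).
Variables (F : p1sheaf A) (G : p1sheaf B).

Lemma twisted_after_res1 (u : sec01 F -> sec01 G) :
  semilinear (map_poly f) u -> twisted f (u \o @res1 A F).
Proof.
move=> ul; split=> [a x y|x] /=; first by rewrite res1_Alinear ul /= map_polyC.
by rewrite -(res1_X x) (semilinearZ ul) /= map_polyX.
Qed.

Lemma twisted_before_res1 (u : sec1 F -> sec1 G) :
  semilinear (map_poly f) u -> twisted f (@res1 B G \o u).
Proof.
move=> ul; split=> [a x y|x] /=; first by rewrite ul /= map_polyC res1_Alinear.
by rewrite (semilinearZ ul) /= map_polyX res1_X.
Qed.

End TwistedComp.

(** * Frames and transition matrices *)

Definition framed (A : comNzRingType) (r : nat) (F : p1sheaf A)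
    (e0 : 'I_r -> sec0 F) (e1 : 'I_r -> sec1 F) (N : nat)
    (G : 'M[{poly A}]_r) : Prop :=
  [/\ is_basis e0, is_basis e1
    & forall i, 'X^N *: res1 (e1 i) = \sum_j G i j *: res0 (e0 j)].

Section Frames.
Variables (A B : comNzRingType) (f : {rmorphism A -> B}).
Variables (F : p1sheaf A) (F' : p1sheaf B) (r : nat).
Variables (e0 : 'I_r -> sec0 F) (e1 : 'I_r -> sec1 F) (N : nat).
Variables (G : 'M[{poly A}]_r).
Hypothesis fr : framed e0 e1 N G.

(** The component on U01 is the localization of the one on U0. Its compatibility with U1 can be
    tested on [e1], where it is the hypothesis. *)
Lemma p1map_of_frames (x0 : 'I_r -> sec0 F') (x1 : 'I_r -> sec1 F') :
  (forall i, 'X^N *: res1 (x1 i) = \sum_j map_poly f (G i j) *: res0 (x0 j)) ->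
  exists u : p1map f F F', (forall i, map0 u (e0 i) = x0 i) /\
    (forall i, map1 u (e1 i) = x1 i).
Proof.
move=> xE; have [b0 b1 gl] := fr.
have [u0 [u0l u0E]] := basis_lift b0 (map_poly f) x0.
have [u1 [u1l u1E]] := basis_lift b1 (map_poly f) x1.
have [u01 [u01l u01E]] := localized_map u0l.
have res1E : forall x, u01 (res1 x) = res1 (u1 x).
  apply: (twisted_basis_ext b1 (twisted_after_res1 u01l) (twisted_before_res1 u1l)).
  move=> i /=; apply: (@sec01_Xn_inj _ F' N); rewrite /= u1E xE.
  have <- : map_poly f 'X^N = 'X^N by rewrite rmorphXn /= map_polyX.
  rewrite -(semilinearZ u01l) gl (semilinear_sum u01l); apply: eq_bigr => j _.
  by rewrite (semilinearZ u01l) u01E u0E.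
by exists (P1Map u0l u1l u01l u01E res1E).
Qed.

Lemma is_pullback_of_frames (u : p1map f F F') :
  is_basis (map0 u \o e0) -> is_basis (map1 u \o e1) -> is_pullback u.
Proof.
have [b0 b1 _] := fr => c0 c1; split.
  exact: (basechange_of_basis b0 (map0_semilinear u) c0).
exact: (basechange_of_basis b1 (map1_semilinear u) c1).
Qed.

Lemma framed_pullback (u : p1map f F F') : is_pullback u ->
  framed (map0 u \o e0) (map1 u \o e1) N (map_mx (map_poly f) G).
Proof.
have [b0 b1 gl] := fr => -[p0 p1].
split; [exact: basechange_basis b0 p0 | exact: basechange_basis b1 p1 |].
move=> i /=; rewrite -map_res1.
have <- : map_poly f 'X^N = 'X^N by rewrite rmorphXn /= map_polyX.
have ul := map01_semilinear u.
rewrite -(semilinearZ ul) gl (semilinear_sum ul); apply: eq_bigr => j _.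
by rewrite (semilinearZ ul) map_res0 mxE.
Qed.

End Frames.

(** * The sheaf glued from an invertible matrix over A[t,1/t] *)

Section LaurentVectors.
Variables (A : comNzRingType) (r : nat).

(** A name of its own, because these row vectors are to carry a second scalar action, that of
    [{poly A}]. *)
Definition lvec := 'rV[laurent A]_r.
HB.instance Definition _ := GRing.Zmodule.on lvec.

Definition lvec_scale (p : {poly A}) (v : lvec) : lvec := lembed p *: (v : 'rV_r).

Fact lvec_scaleA p q v : lvec_scale p (lvec_scale q v) = lvec_scale (p * q) v.
Proof. by rewrite /lvec_scale scalerA rmorphM. Qed.

Fact lvec_scale1 : left_id 1 lvec_scale.
Proof. by move=> v; rewrite /lvec_scale rmorph1 scale1r. Qed.

Fact lvec_scaleDr : right_distributive lvec_scale +%R.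
Proof. by move=> p v w; rewrite /lvec_scale scalerDr. Qed.

Fact lvec_scaleDl v : {morph lvec_scale^~ v : p q / p + q}.
Proof. by move=> p q; rewrite /lvec_scale rmorphD scalerDl. Qed.

HB.instance Definition _ := GRing.Zmodule_isLmodule.Build {poly A} lvec
  lvec_scaleA lvec_scale1 lvec_scaleDr lvec_scaleDl.

Lemma lvec_scaleE (p : {poly A}) (v : lvec) :
  p *: v = lembed p *: (v : 'rV_r) :> 'rV_r.
Proof. by []. Qed.

End LaurentVectors.

Section GluedSheaf.
Variables (A : comNzRingType) (r : nat) (M M' : 'M[laurent A]_r).
Hypothesis MM' : M *m M' = 1%:M.

Definition glued0 (v : 'rV[{poly A}]_r) : lvec A r := map_mx (@lembed A) v.
Definition glued1 (v : 'rV[{poly A}]_r) : lvec A r := map_mx (@lneg A) v *m M.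

Fact glued_bij : bijective (fun y : lvec A r => 'X *: y).
Proof.
exists (fun y => linvX A *: (y : 'rV_r)) => y.
  by rewrite lvec_scaleE scalerA linvXl scale1r.
by rewrite lvec_scaleE scalerA mulrC linvXl scale1r.
Qed.

Fact glued0_linear (a : {poly A}) x y :
  glued0 (a *: x + y) = a *: glued0 x + glued0 y.
Proof. by rewrite /glued0 map_mxD map_mxZ. Qed.

Fact glued1_Alinear (a : A) x y :
  glued1 (a%:P *: x + y) = a%:P *: glued1 x + glued1 y.
Proof. by rewrite /glued1 map_mxD map_mxZ /= lnegC mulmxDl -scalemxAl. Qed.

Fact glued1_X x : 'X *: glued1 ('X *: x) = glued1 x.
Proof.
rewrite /glued1 map_mxZ /= lnegX -scalemxAl lvec_scaleE scalerA.
by rewrite mulrC linvXl scale1r.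
Qed.

Fact glued0_ker x : glued0 x = 0 -> exists n : nat, 'X^n *: x = 0.
Proof.
move=> x0; exists 0%N; rewrite expr0 scale1r; apply/rowP => i.
apply: (@lembed_inj A); rewrite mxE rmorph0.
by move/(congr1 (fun v : 'rV_r => v 0 i)): x0; rewrite !mxE.
Qed.

Fact glued0_onto (y : lvec A r) : exists (n : nat) x, 'X^n *: y = glued0 x.
Proof.
have ex i : exists w : nat * {poly A}, lembed 'X ^+ w.1 * y 0 i == lembed w.2.
  by have [n [p e]] := lembed_onto (y 0 i); exists (n, p); rewrite e.
pose w i := xchoose (ex i); pose n := \max_i (w i).1.
have wP i : lembed 'X ^+ (w i).1 * y 0 i = lembed (w i).2 := eqP (xchooseP (ex i)).
exists n, (\row_i ('X^(n - (w i).1) * (w i).2)); apply/rowP => i.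
rewrite !mxE rmorphM /= -wP mulrA -rmorphXn -rmorphM -exprD.
by rewrite subnK // /n (bigmax_sup i).
Qed.

Fact glued1_ker x : glued1 x = 0 -> exists n : nat, 'X^n *: x = 0.
Proof.
move=> /(congr1 (fun v : 'rV_r => v *m M')).
rewrite /= /glued1 -mulmxA MM' mulmx1 mul0mx => x0.
exists 0%N; rewrite expr0 scale1r; apply/rowP => i; rewrite mxE.
apply: lneg_eq0; by move/(congr1 (fun v : 'rV_r => v 0 i)): x0; rewrite !mxE.
Qed.

Fact glued1_onto (y : lvec A r) : exists (n : nat) x, y = 'X^n *: glued1 x.
Proof.
pose z : 'rV_r := (y : 'rV_r) *m M'.
have ex i : exists w : nat * {poly A}, z 0 i == lembed 'X^(w.1) * lneg w.2.
  by have [n [p e]] := lneg_onto (z 0 i); exists (n, p); rewrite e.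
pose w i := xchoose (ex i); pose n := \max_i (w i).1.
have wP i : z 0 i = lembed 'X^((w i).1) * lneg (w i).2 := eqP (xchooseP (ex i)).
exists n, (\row_i ('X^(n - (w i).1) * (w i).2)).
rewrite /glued1 lvec_scaleE scalemxAl.
transitivity (z *m M); first by rewrite -mulmxA (mulmx1C MM') mulmx1.
congr (_ *m _); apply/rowP => i; rewrite [in RHS]mxE [in RHS]mxE [in RHS]mxE rmorphM /= wP.
have wn : ((w i).1 <= n)%N by rewrite /n (bigmax_sup i).
rewrite -{1}(subnK wn) exprD rmorphM mulrACA lposnegXn mul1r.
by [].
Qed.

Definition glued_sheaf : p1sheaf A :=
  P1Sheaf glued_bij glued0_linear glued1_Alinear glued1_X glued0_ker glued0_onto
    glued1_ker glued1_onto.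

Lemma glued_framed (N : nat) (G : 'M[{poly A}]_r) :
  lembed 'X^N *: M = map_mx (@lembed A) G ->
  @framed A r glued_sheaf (fun i => delta_mx 0 i) (fun i => delta_mx 0 i) N G.
Proof.
move=> MG; split; [exact: basis_delta | exact: basis_delta | move=> i].
rewrite /= /glued1 /glued0 map_delta_mx -rowE.
transitivity (row i (lembed 'X^N *: M)); first by apply/rowP => j; rewrite !mxE.
rewrite MG [LHS]row_sum_delta; apply: eq_bigr => j _.
by rewrite map_delta_mx !mxE.
Qed.

End GluedSheaf.

(** * The twisted symmetric square *)

Local Notation i0 := (ord0 : 'I_2).
Local Notation i1 := (lift ord0 ord0 : 'I_2).

Lemma sum2E (V : nmodType) (F : 'I_2 -> V) : \sum_i F i = F i0 + F i1.
Proof. by rewrite big_ord_recl big_ord1. Qed.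

Lemma sum3E (V : nmodType) (F : 'I_3 -> V) :
  \sum_i F i = F ord0 + (F (lift ord0 ord0) + F (lift ord0 (lift ord0 ord0))).
Proof. by rewrite !big_ord_recl big_ord0 addr0. Qed.

Lemma ord2P (P : 'I_2 -> Prop) : P i0 -> P i1 -> forall i, P i.
Proof.
move=> P0 P1 [[|[|//]] lti].
  by rewrite (_ : Ordinal lti = ord0) //; apply: val_inj.
by rewrite (_ : Ordinal lti = lift ord0 ord0) //; apply: val_inj.
Qed.

Lemma ord3P (P : 'I_3 -> Prop) : P ord0 -> P (lift ord0 ord0) ->
  P (lift ord0 (lift ord0 ord0)) -> forall i, P i.
Proof.
move=> P0 P1 P2 [[|[|[|//]]] lti].
- by rewrite (_ : Ordinal lti = ord0) //; apply: val_inj.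
- by rewrite (_ : Ordinal lti = lift ord0 ord0) //; apply: val_inj.
by rewrite (_ : Ordinal lti = lift ord0 (lift ord0 ord0)) //; apply: val_inj.
Qed.

Lemma is_basis_ext (R : nzRingType) (M : lmodType R) r (e e' : 'I_r -> M) :
  e =1 e' -> is_basis e -> is_basis e'.
Proof.
move=> ee' [sp ind]; split=> [m|c c0].
  by have [c ->] := sp m; exists c; apply: eq_bigr => i _; rewrite ee'.
by apply: ind; under eq_bigr do rewrite ee'.
Qed.

(* The products e0^2, e0 e1, e1^2 of two frame vectors are indexed by 'I_3. *)
Definition symfst (a : 'I_3) : 'I_2 := if val a == 2 then i1 else i0.
Definition symsnd (a : 'I_3) : 'I_2 := if val a == 0 then i0 else i1.

Definition symcoef (R : nzRingType) (v w : 'I_2 -> R) (a : 'I_3) : R :=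
  match val a with
  | 0 => v i0 * w i0
  | 1 => v i0 * w i1 + v i1 * w i0
  | _ => v i1 * w i1
  end.

Lemma rmorph_symcoef (R R' : nzRingType) (phi : {rmorphism R -> R'}) v w a :
  phi (symcoef v w a) = symcoef (phi \o v) (phi \o w) a.
Proof.
by elim/ord3P: a; rewrite /symcoef /= ?rmorphD ?rmorphM.
Qed.

Section Trilinear.
Variables (R : comNzRingType) (V L S : lmodType R) (mu : V -> V -> L -> S).
Hypothesis mut : sym_trilinear mu.

Lemma tril1 w l : semilinear idfun (fun v => mu v w l).
Proof. by case: mut => h _ _ a x y; exact: h. Qed.

Lemma tril2 v l : semilinear idfun (fun w => mu v w l).
Proof. by case: mut => h sym _ a x y; rewrite sym h sym (sym y). Qed.

Lemma tril3 v w : semilinear idfun (mu v w).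
Proof. by case: mut => _ _ h a x y; exact: h. Qed.

Lemma trilZ a b c v w l : mu (a *: v) (b *: w) (c *: l) = (a * b * c) *: mu v w l.
Proof.
rewrite (semilinearZ (tril1 _ _)) (semilinearZ (tril2 _ _)).
by rewrite (semilinearZ (tril3 _ _)) /= !scalerA.
Qed.

Lemma tril_expand (e : 'I_2 -> V) (l : L) v w c :
  mu (\sum_i v i *: e i) (\sum_i w i *: e i) (c *: l) =
  \sum_a (c * symcoef v w a) *: mu (e (symfst a)) (e (symsnd a)) l.
Proof.
have sym : forall x y z, mu x y z = mu y x z by case: mut.
rewrite !sum2E sum3E /symcoef /symfst /symsnd /=.
rewrite (semilinearD (tril1 _ _)) !(semilinearD (tril2 _ _)) !trilZ.
rewrite (sym (e i1) (e i0)) mulrDr scalerDl !addrA.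
by congr (_ + _ + _ + _); congr (_ *: _); ring.
Qed.

End Trilinear.

Section Sym2Bases.
Variables (R : comNzRingType) (V L S : lmodType R) (mu : V -> V -> L -> S).
Variables (e : 'I_2 -> V) (l : 'I_1 -> L).
Hypotheses (eb : is_basis e) (lb : is_basis l).

Definition sym2_frame (a : 'I_3) : S := mu (e (symfst a)) (e (symsnd a)) (l ord0).

Lemma basis1_span (x : L) : exists c, x = c *: l ord0.
Proof. by have [c ->] := lb.1 x; exists (c ord0); rewrite big_ord1. Qed.

Lemma sym2_induced (R' : comNzRingType) (phi : {rmorphism R -> R'})
    (V' L' S' : lmodType R') (mu' : V' -> V' -> L' -> S')
    (u : V -> V') (t : L -> L') :
  sym_trilinear mu -> is_basis sym2_frame -> sym_trilinear mu' ->
  semilinear phi u -> semilinear phi t ->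
  exists s : S -> S', semilinear phi s /\
    forall v w x, s (mu v w x) = mu' (u v) (u w) (t x).
Proof.
move=> mut sb mut' ul tl.
have [s [sl sE]] := basis_lift sb phi
  (fun a => mu' (u (e (symfst a))) (u (e (symsnd a))) (t (l ord0))).
exists s; split=> // v w x.
have [cv ->] := eb.1 v; have [cw ->] := eb.1 w; have [c ->] := basis1_span x.
have uE d : u (\sum_i d i *: e i) = \sum_i phi (d i) *: u (e i).
  by rewrite (semilinear_sum ul); apply: eq_bigr => i _; rewrite (semilinearZ ul).
rewrite (tril_expand mut) (semilinear_sum sl) !uE (semilinearZ tl).
rewrite (tril_expand mut' (fun i => u (e i))); apply: eq_bigr => a _.
by rewrite (semilinearZ sl) sE rmorphM rmorph_symcoef.
Qed.

Lemma sym2_of_basis :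
  sym_trilinear mu -> is_basis sym2_frame -> is_sym2_tensor mu.
Proof.
move=> mut sb; split=> // N beta bt; split.
  have [s [sl sE]] := sym2_induced mut sb bt
    (semilinear_linear (idfun : {linear V -> V}))
    (semilinear_linear (idfun : {linear L -> L})).
  by have [h hE] := ex_linear sl; exists h => v w x; rewrite hE sE.
move=> h h' hh'.
apply: (basis_ext sb (semilinear_linear h) (semilinear_linear h')) => a.
exact: hh'.
Qed.

End Sym2Bases.

Section Sym2Row.
Variable R : comNzRingType.
Implicit Types (v w : 'rV[R]_2) (x : 'rV[R]_1).

(** The product in the coordinate model of Sym^2 (x) line, with basis e0^2, e0 e1, e1^2. *)
Definition sym2_row v w x : 'rV[R]_3 := \row_a (x 0 0 * symcoef (v 0) (w 0) a).

Lemma sym2_row_trilinear : sym_trilinear sym2_row.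
Proof.
split=> [a v v' w x|v w x|a v w x x']; apply/rowP;
  apply: ord3P; rewrite !mxE /symcoef /= ?mxE; ring.
Qed.

Lemma sym2_row_delta a : sym2_frame sym2_row (fun i => delta_mx 0 i)
  (fun i => delta_mx 0 i) a = delta_mx 0 a.
Proof.
apply/rowP => b; rewrite !mxE /symcoef; elim/ord3P: a; elim/ord3P: b;
  rewrite /symfst /symsnd /= !mxE /=; ring.
Qed.

Lemma sym2_row_universal : is_sym2_tensor sym2_row.
Proof.
apply: (sym2_of_basis (basis_delta R 2) (basis_delta R 1) sym2_row_trilinear).
by apply: is_basis_ext (basis_delta R 3) => a; rewrite sym2_row_delta.
Qed.

(** The matrix of Sym^2 M (x) c. Applied to the gluing data of V and L, it is the gluing matrix of
    Sym^2 V (x) L. *)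
Definition sym2_mx (M : 'M[R]_2) (c : R) : 'M[R]_3 :=
  \matrix_a sym2_row (row (symfst a) M) (row (symsnd a) M) c%:M.

Lemma sym2_row_mulmx v w x M c : 
  sym2_row (v *m M) (w *m M) (x *m c%:M) = sym2_row v w x *m sym2_mx M c.
Proof.
apply/rowP; apply: ord3P; rewrite !mxE sum3E big_ord1 !mxE /symcoef /symfst
  /symsnd /= !mxE !sum2E /= ord1; ring.
Qed.

Lemma sym2_mx_mul M N c d : M *m N = 1%:M -> c * d = 1 ->
  sym2_mx M c *m sym2_mx N d = 1%:M.
Proof.
move=> MN cd; apply/row_matrixP => a; rewrite row_mul rowK -sym2_row_mulmx.
rewrite -!row_mul MN -scalar_mxM cd !row1 -(sym2_row_delta a) /sym2_frame.
by congr sym2_row; apply/rowP => i; rewrite !ord1 !mxE.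
Qed.

End Sym2Row.

Lemma basis_of_coord (R : nzRingType) (M : lmodType R) r (x : 'I_r -> M)
    (h : {linear M -> 'rV[R]_r}) :
  (forall m, m = \sum_i h m 0 i *: x i) -> (forall i, h (x i) = delta_mx 0 i) ->
  is_basis x.
Proof.
move=> hK hx; split=> [m|c c0]; first by exists (h m 0).
apply: (basis_delta R r).2; transitivity (h 0); last exact: linear0.
by rewrite -c0 linear_sum; apply: eq_bigr => i _; rewrite linearZ /= hx.
Qed.

(** The universal property gives [h] from [S] to the coordinate model. The map [g] back satisfies g
    h = id by uniqueness, as g h fixes all products. *)
Lemma sym2_basis (R : comNzRingType) (V L S : lmodType R) (mu : V -> V -> L -> S)
    (e : 'I_2 -> V) (l : 'I_1 -> L) :
  is_basis e -> is_basis l -> is_sym2_tensor mu -> is_basis (sym2_frame mu e l).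
Proof.
move=> eb lb [mut muP].
have [p [pl pE]] := basis_lift eb idfun (fun i => delta_mx 0 i : 'rV[R]_2).
have [q [ql qE]] := basis_lift lb idfun (fun i => delta_mx 0 i : 'rV[R]_1).
have bt : sym_trilinear (fun v w x => sym2_row (p v) (p w) (q x)).
  have [h1 h2 h3] := sym2_row_trilinear R.
  by split=> [a v v' w x|v w x|a v w x x']; rewrite ?pl ?ql /= ?h1 ?h3 // h2.
have [[h hE] _] := muP _ _ bt; have [_ uniq] := muP _ _ mut.
apply: (@basis_of_coord _ _ _ _ h) => [m|a]; last first.
  by rewrite hE !pE !qE -[RHS]sym2_row_delta.
have [g [gl gE]] := basis_lift (basis_delta R 3) idfun (sym2_frame mu e l).
have [g' g'E] := ex_linear gl.
rewrite -[LHS](uniq (g' \o h) idfun) /= => [|v w x].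
  by rewrite g'E {1}[h m]row_sum_delta (semilinear_sum gl); apply: eq_bigr => a _;
    rewrite (semilinearZ gl) gE.
have [cv ->] := eb.1 v; have [cw ->] := eb.1 w; have [c ->] := basis1_span lb x.
rewrite (tril_expand mut) linear_sum g'E (semilinear_sum gl); apply: eq_bigr => a _.
rewrite linearZ /= (semilinearZ gl) hE; congr (_ *: _).
by rewrite !pE !qE -[sym2_row _ _ _]/(sym2_frame _ (fun i => delta_mx 0 i)
  (fun i => delta_mx 0 i) a) sym2_row_delta gE.
Qed.

Lemma sym2_ext (R : comNzRingType) (V L S : lmodType R) (mu : V -> V -> L -> S)
    (e : 'I_2 -> V) (l : 'I_1 -> L) (R' : nzRingType) (phi : {rmorphism R -> R'})
    (N : lmodType R') (s s' : S -> N) :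
  is_basis e -> is_basis l -> is_sym2_tensor mu ->
  semilinear phi s -> semilinear phi s' ->
  (forall v w x, s (mu v w x) = s' (mu v w x)) -> s =1 s'.
Proof.
move=> eb lb mU sl sl' ss'; apply: (basis_ext (sym2_basis eb lb mU) sl sl') => a.
exact: ss'.
Qed.

Section GluedSym2.
Variables (A : comNzRingType) (M M' : 'M[laurent A]_2) (c c' : laurent A).
Hypotheses (MM' : M *m M' = 1%:M) (cc' : c * c' = 1).

Fact scalar_mx_inv : c%:M *m c'%:M = 1%:M :> 'M_1.
Proof. by rewrite -scalar_mxM cc'. Qed.

Let V := glued_sheaf MM'.
Let L := glued_sheaf scalar_mx_inv.
Let S := glued_sheaf (sym2_mx_mul MM' cc').

Definition glued_mul01 (v w : sec01 V) (x : sec01 L) : sec01 S := sym2_row v w x.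

Fact glued_mul01_trilinear : sym_trilinear glued_mul01.
Proof.
have [h1 h2 h3] := sym2_row_trilinear (laurent A).
split=> [a v v' w x|v w x|a v w x x']; [exact: (h1 (lembed a)) | exact: h2 |].
exact: (h3 (lembed a)).
Qed.

Lemma map_sym2_row (R R' : comNzRingType) (phi : {rmorphism R -> R'})
    (v w : 'rV[R]_2) (x : 'rV[R]_1) :
  map_mx phi (sym2_row v w x) = sym2_row (map_mx phi v) (map_mx phi w) (map_mx phi x).
Proof.
apply/rowP => a; rewrite !mxE rmorphM rmorph_symcoef.
by rewrite /symcoef /= !mxE.
Qed.

Fact glued_mul_res0 (v w : sec0 V) (x : sec0 L) :
  @res0 A S (sym2_row v w x) = glued_mul01 (res0 v) (res0 w) (res0 x).
Proof. exact: map_sym2_row. Qed.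

Fact glued_mul_res1 (v w : sec1 V) (x : sec1 L) :
  @res1 A S (sym2_row v w x) = glued_mul01 (res1 v) (res1 w) (res1 x).
Proof. by rewrite /= /glued_mul01 /glued1 sym2_row_mulmx map_sym2_row. Qed.

Definition glued_sym2 : sym2_twist V L S :=
  @Sym2Twist A V L S _ _ _ (sym2_row_universal _) (sym2_row_universal _)
    glued_mul01_trilinear glued_mul_res0 glued_mul_res1.

End GluedSym2.

Section InducedMap.
Variables (A B : comNzRingType) (f : {rmorphism A -> B}).
Variables (V L S : p1sheaf A) (m : sym2_twist V L S).
Variables (V' L' S' : p1sheaf B) (m' : sym2_twist V' L' S').
Variables (e0 : 'I_2 -> sec0 V) (e1 : 'I_2 -> sec1 V).
Variables (l0 : 'I_1 -> sec0 L) (l1 : 'I_1 -> sec1 L).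
Hypotheses (e0b : is_basis e0) (e1b : is_basis e1).
Hypotheses (l0b : is_basis l0) (l1b : is_basis l1).
Variables (u : p1map f V V') (t : p1map f L L').

Lemma sym2_p1map : exists s : p1map f S S',
  (forall v w x, map0 s (mul0 m v w x) = mul0 m' (map0 u v) (map0 u w) (map0 t x)) /\
  (forall v w x, map1 s (mul1 m v w x) = mul1 m' (map1 u v) (map1 u w) (map1 t x)).
Proof.
have b0 := sym2_basis e0b l0b (mul0_univ m).
have b1 := sym2_basis e1b l1b (mul1_univ m).
have [s0 [s0l s0E]] := sym2_induced e0b l0b (mul0_univ m).1 b0 (mul0_univ m').1
  (map0_semilinear u) (map0_semilinear t).
have [s1 [s1l s1E]] := sym2_induced e1b l1b (mul1_univ m).1 b1 (mul1_univ m').1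
  (map1_semilinear u) (map1_semilinear t).
have [s01 [s01l s01E]] := localized_map s0l.
(* Clearing the denominators of the three arguments reduces the claim to U0. *)
have s01M y1 y2 y3 : s01 (mul01 m y1 y2 y3) =
    mul01 m' (map01 u y1) (map01 u y2) (map01 t y3).
  have [n1 [x1 yx1]] := res0_onto y1; have [n2 [x2 yx2]] := res0_onto y2.
  have [n3 [x3 yx3]] := res0_onto y3.
  have fX n : map_poly f 'X^n = 'X^n by rewrite rmorphXn /= map_polyX.
  apply: (@sec01_Xn_inj _ S' (n1 + n2 + n3)); rewrite /= !exprD.
  rewrite -(trilZ (mul01_trilinear m')) -!fX -!rmorphM -(semilinearZ s01l).
  rewrite -(trilZ (mul01_trilinear m)) -!(semilinearZ (map01_semilinear _)).
  by rewrite yx1 yx2 yx3 -mul_res0 s01E s0E mul_res0 !map_res0.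
have s01_res1 : forall x, s01 (res1 x) = res1 (s1 x).
  apply: (twisted_basis_ext b1 (twisted_after_res1 s01l) (twisted_before_res1 s1l)).
  by move=> a /=; rewrite /sym2_frame mul_res1 s01M !map_res1 -mul_res1 s1E.
by exists (P1Map s0l s1l s01l s01E s01_res1).
Qed.

End InducedMap.

(** * Global generation of Sym^2 V (x) L when V is split *)

Section DiagonalFrames.
Variables (A : comNzRingType) (V L S : p1sheaf A) (m : sym2_twist V L S).
Variables (e0 : 'I_2 -> sec0 V) (e1 : 'I_2 -> sec1 V).
Variables (l0 : sec0 L) (l1 : sec1 L) (N : nat) (d : 'I_2 -> nat) (a b : nat).
Hypotheses (e0b : is_basis e0) (e1b : is_basis e1).
Hypotheses (l0b : is_basis (fun _ : 'I_1 => l0)) (l1b : is_basis (fun _ : 'I_1 => l1)).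
Hypothesis eE : forall i, 'X^N *: res1 (e1 i) = 'X^(d i) *: res0 (e0 i).
Hypothesis lE : 'X^b *: res1 l1 = 'X^a *: res0 l0.

Let q0 := sym2_frame (mul0 m) e0 (fun=> l0).
Let q1 := sym2_frame (mul1 m) e1 (fun=> l1).
Let deg c := (d (symfst c) + d (symsnd c) + a)%N.

Lemma diag_sym2_frame c : 'X^(N + N + b) *: res1 (q1 c) = 'X^(deg c) *: res0 (q0 c).
Proof.
rewrite /q1 /q0 /sym2_frame mul_res0 mul_res1 /deg !exprD.
by rewrite -!(trilZ (mul01_trilinear m)) !eE lE.
Qed.

(** S is a sum of three line bundles, of degrees deg c - (2N + b). The bounds for the two squares
    imply the one for the mixed product, and in nonnegative degree both frame vectors of a summand
    extend to global sections. *)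
Lemma globally_generated_diag :
  (forall i, N + N + b <= d i + d i + a)%N -> globally_generated S.
Proof.
move=> dN; have dN' c : (N + N + b <= deg c)%N.
  by rewrite /deg; have := dN (symfst c); have := dN (symsnd c); lia.
pose n c := (deg c - (N + N + b))%N.
have qE c : res1 (q1 c) = 'X^(n c) *: res0 (q0 c).
  apply: (@sec01_Xn_inj _ S (N + N + b)); rewrite /= diag_sym2_frame scalerA.
  by rewrite -exprD subnKC.
have r0 : semilinear idfun (@res0 A S) := @res0_semilinear A S.
have g1 c : res0 ('X^(n c) *: q0 c) = res1 (q1 c).
  by rewrite qE (semilinearZ r0).
have g0 c : res0 (q0 c) = res1 ('X^(n c) *: q1 c).
  apply: (@sec01_Xn_inj _ S (n c)); rewrite /= -qE.
  by rewrite (twistedXn (res1_twisted S)).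
split=> x.
  have [c ->] := (sym2_basis e0b l0b (mul0_univ m)).1 x.
  by exists 3%N, c, (fun c => GlobalSection (g0 c)).
have [c ->] := (sym2_basis e1b l1b (mul1_univ m)).1 x.
by exists 3%N, c, (fun c => GlobalSection (g1 c)).
Qed.

(** A summand of negative degree has no nonzero section, so global sections cannot generate it. *)
Lemma diag_globally_generated : globally_generated S ->
  forall i, (N + N + b <= d i + d i + a)%N.
Proof.
(* The summand of the square of frame vector [i]. *)
case=> gg _ i; pose c : 'I_3 := if i == ord0 then ord0 else ord_max.
have -> : (d i + d i + a)%N = deg c by rewrite /deg /c; clear c; elim/ord2P: i.
have b0 := sym2_basis e0b l0b (mul0_univ m).
have b1 := sym2_basis e1b l1b (mul1_univ m).
have r0 : semilinear idfun (@res0 A S) := @res0_semilinear A S.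
have [s [k [h hE]]] := gg (q0 c).
have [co0 [co0l co0E]] := basis_lift b0 idfun (fun i => delta_mx 0 i : 'rV[{poly A}]_3).
have [j pn0] : exists j, co0 (gs0 (h j)) 0 c != 0.
  apply/existsP; apply: contraT; rewrite negb_exists => /forallP h0.
  have := congr1 (fun v : 'rV_3 => v 0 c) (co0E c); rewrite -/(q0 c) hE.
  rewrite (semilinear_sum co0l) summxE big1 => [|j _].
    by rewrite !mxE !eqxx => /eqP; rewrite eq_sym oner_eq0.
  by rewrite (semilinearZ co0l) !mxE (eqP (negbNE (h0 j))) mulr0.
have [p pE] := b0.1 (gs0 (h j)); have [p' p'E] := b1.1 (gs1 (h j)).
have {}pn0 : p c != 0.
  apply: contraNneq pn0 => p0; rewrite pE (semilinear_sum co0l) summxE big1 // => l _.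
  rewrite (semilinearZ co0l) co0E !mxE eqxx /=.
  by case: eqP => [<-|_]; rewrite ?p0 ?mul0r ?mulr0.
pose D := \max_l size (p' l).
(* The coordinates of one section over U0 and over U1, compared on U01. The factor t^D turns those
   over U1 into polynomials in t. *)
have key : \sum_l ('X^(N + N + b + D) * p l - revp D (p' l) * 'X^(deg l)) *: res0 (q0 l) = 0.
  under eq_bigr do rewrite scalerBl; rewrite sumrB; apply/eqP; rewrite subr_eq0.
  have -> : \sum_l ('X^(N + N + b + D) * p l) *: res0 (q0 l) =
      'X^(N + N + b + D) *: res0 (gs0 (h j)).
    rewrite pE (semilinear_sum r0) scaler_sumr; apply: eq_bigr => l _.
    by rewrite (semilinearZ r0) scalerA.
  rewrite gs_glue p'E (twisted_sum (res1_twisted S)) scaler_sumr; apply/eqP; apply: eq_bigr => l _.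
  rewrite exprD -scalerA res1Z; last by rewrite ltnW // ltnS /D (bigmax_sup l).
  by rewrite scalerA mulrC -scalerA -/(q1 l) diag_sym2_frame scalerA.
have [n kn] : exists n, 'X^n *: \sum_l
    ('X^(N + N + b + D) * p l - revp D (p' l) * 'X^(deg l)) *: q0 l = 0.
  apply: res0_ker; rewrite -[RHS]key (semilinear_sum r0); apply: eq_bigr => l _.
  by rewrite (semilinearZ r0).
have {kn} : 'X^n * ('X^(N + N + b + D) * p c - revp D (p' c) * 'X^(deg c)) = 0.
  apply: (b0.2 (fun l => 'X^n * ('X^(N + N + b + D) * p l - revp D (p' l) * 'X^(deg l)))).
  by rewrite -[RHS]kn scaler_sumr; apply: eq_bigr => l _; rewrite scalerA.
rewrite -[RHS](mulr0 'X^n) => /(@polyXn_lreg A n) /eqP; rewrite subr_eq0 => /eqP e.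
(* The side with [p c], which is nonzero, has degree at least N + N + b + D; the other has degree at
   most D + deg c. *)
have := size_polyMleq (revp D (p' c)) 'X^(deg c); rewrite -e mulrC.
rewrite size_mulXn // size_polyXn addnS /= => le1.
move: pn0 le1 (size_revp D (p' c)); rewrite -size_poly_gt0.
move: (size (p c)) (size (revp _ _)) (deg c) => x y z.
by clearbody D => ? ? ?; lia.
Qed.

End DiagonalFrames.

(** * Splitting of rank 2 bundles *)

Lemma det2E (R : comNzRingType) (G : 'M[R]_2) :
  \det G = G i0 i0 * G i1 i1 - G i0 i1 * G i1 i0.
Proof.
rewrite (expand_det_row G ord0) sum2E /cofactor !det_mx11 !mxE /= expr0 expr1.
have -> : lift ord0 0 = i1 :> 'I_2 by apply: val_inj.
have -> : lift i1 0 = i0 :> 'I_2 by apply: val_inj.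
by rewrite mul1r mulN1r mulrN.
Qed.

Lemma adj2E (R : comNzRingType) (G : 'M[R]_2) :
  (\adj G i0 i0 = G i1 i1) * (\adj G i0 i1 = - G i0 i1) *
  (\adj G i1 i0 = - G i1 i0) * (\adj G i1 i1 = G i0 i0).
Proof.
rewrite !mxE /cofactor !det_mx11 !mxE /= expr0 expr1 expr2 mulrNN !mul1r !mulN1r.
have -> : lift ord0 0 = i1 :> 'I_2 by apply: val_inj.
by have -> : lift i1 0 = i0 :> 'I_2 by apply: val_inj.
Qed.

(** * Column reduction of 2 by 2 polynomial matrices *)

Section ColumnReduction.
Variable K : fieldType.
Implicit Types G P : 'M[{poly K}]_2.

Definition col_bounded G (mu : 'I_2 -> nat) : Prop :=
  forall i j, (size (G i j) <= (mu j).+1)%N.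

Lemma coefM_bound (p q : {poly K}) m n :
  (size p <= m.+1)%N -> (size q <= n.+1)%N -> (p * q)`_(m + n) = p`_m * q`_n.
Proof.
move=> sp sq; rewrite coefM (bigD1 (inord m)) //= inordK ?ltnS ?leq_addr //.
rewrite addKn big1 ?addr0 // => j jm.
case: (ltngtP j m) => [jlt|jgt|je].
- by rewrite [q`_ _]nth_default ?mulr0 // (leq_trans sq) // ltn_subRL ltn_add2r.
- by rewrite nth_default ?mul0r // (leq_trans sp).
by case/eqP: jm; apply: val_inj; rewrite /= inordK // ltnS leq_addr.
Qed.

Lemma sizeM_bound (p q : {poly K}) m n :
  (size p <= m.+1)%N -> (size q <= n.+1)%N -> (size (p * q)%R <= (m + n).+1)%N.
Proof. by move=> sp sq; apply: leq_trans (size_polyMleq p q) _; lia. Qed.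

Lemma sizeB_bound (p q : {poly K}) n :
  (size p <= n)%N -> (size q <= n)%N -> (size (p - q)%R <= n)%N.
Proof.
by move=> sp sq; rewrite (leq_trans (size_polyD _ _)) // geq_max sp size_polyN.
Qed.

Lemma size_leq_coef0 (p : {poly K}) n :
  (size p <= n.+1)%N -> p`_n = 0 -> (size p <= n)%N.
Proof.
move=> sp pn; apply/leq_sizeP => j; rewrite leq_eqVlt => /orP[/eqP <- //|nj].
by rewrite nth_default // (leq_trans sp).
Qed.

Lemma proportional (a b c d : K) : a * d = b * c -> ~~ ((b == 0) && (d == 0)) ->
  exists x, a = x * b /\ c = x * d.
Proof.
move=> e; rewrite negb_and => /orP[b0|d0].
  by exists (a / b); rewrite divfK // mulrAC e mulrAC mulfV // mul1r.
by exists (c / d); rewrite divfK // mulrAC -[X in X / d]mulrC -e mulfK.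
Qed.

(** If neither column is zero, each is a multiple of the other, so [j] can be chosen with the larger
    bound. If one is zero, x = 0 works and the bounds do not matter. *)
Lemma dependent_columns (l : 'I_2 -> 'I_2 -> K) (mu : 'I_2 -> nat) :
  l i0 i0 * l i1 i1 = l i0 i1 * l i1 i0 ->
  exists j j' x, [/\ j != j', x = 0 \/ (mu j' <= mu j)%N &
    forall i, l i j = x * l i j'].
Proof.
move=> e; have e' : l i0 i1 * l i1 i0 = l i0 i0 * l i1 i1 by [].
have [/andP[/eqP l0 /eqP l1]|n0] := boolP ((l i0 i0 == 0) && (l i1 i0 == 0)).
  exists i0, i1, 0; split=> //; first by left.
  by apply: ord2P; rewrite mul0r.
have [/andP[/eqP l0 /eqP l1]|n1] := boolP ((l i0 i1 == 0) && (l i1 i1 == 0)).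
  exists i1, i0, 0; split=> //; first by left.
  by apply: ord2P; rewrite mul0r.
have [le|lt] := leqP (mu i1) (mu i0).
  have [x [x0 x1]] := proportional e n1.
  by exists i0, i1, x; split=> //; [right | apply: ord2P].
have [x [x0 x1]] := proportional e' n0.
by exists i1, i0, x; split=> //; [right; apply: ltnW | apply: ord2P].
Qed.

(** Induction on the sum of the column bounds. The coefficient of det G in that degree is the
    determinant of the leading coefficients; when it vanishes, one column can be lowered by a
    multiple of the other. *)
Lemma column_reduction G : \det G != 0 -> exists P (mu : 'I_2 -> nat),
  [/\ P \in unitmx, col_bounded (G *m P) mu & size (\det G) = (mu i0 + mu i1).+1].
Proof.
move=> G0; pose mu0 j := (size (G i0 j) + size (G i1 j))%N.
have : col_bounded G mu0.
  by move=> i j; rewrite /mu0; elim/ord2P: i; lia.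
have [s] := ubnP (mu0 i0 + mu0 i1); move: mu0.
elim: s G G0 => [//|s IH] G G0 mu les bG.
pose l i j := (G i j)`_(mu j).
have detc : (\det G)`_(mu i0 + mu i1) = l i0 i0 * l i1 i1 - l i0 i1 * l i1 i0.
  by rewrite det2E coefB coefM_bound // mulrC addnC coefM_bound // mulrC.
have dets : (size (\det G) <= (mu i0 + mu i1).+1)%N.
  rewrite det2E; apply: sizeB_bound; first exact: sizeM_bound.
  by rewrite addnC; apply: sizeM_bound.
have [d0|d0] := eqVneq ((\det G)`_(mu i0 + mu i1)) 0; last first.
  exists 1%:M, mu; split; rewrite ?unitmx1 ?mulmx1 //.
  apply/eqP; rewrite eqn_leq dets ltnNge; apply: contra d0 => sd.
  by rewrite nth_default.
have [j [j' [x [jj' x0 lx]]]] : exists j j' x, [/\ j != j',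
    x = 0 \/ (mu j' <= mu j)%N & forall i, l i j = x * l i j'].
  by apply: dependent_columns; apply/eqP; rewrite -subr_eq0 -detc d0.
(* Right multiplication by 1 - q E subtracts q times column j' from column j, which kills the
   leading coefficients of column j. As E^2 = 0, the inverse is 1 + q E. *)
pose q : {poly K} := x *: 'X^(mu j - mu j'); pose E := delta_mx j' j : 'M[{poly K}]_2.
have EE : E *m E = 0 by rewrite mul_delta_mx_0.
pose P := 1%:M - q *: E; pose P' := 1%:M + q *: E.
have PP' : P *m P' = 1%:M.
  rewrite /P /P' mulmxDr mulmx1 mulmxBl mul1mx -scalemxAl -scalemxAr EE !scaler0.
  by rewrite subr0 subrK.
have [Pu _] := mulmx1_unit PP'.
have GPE i k : (G *m P) i k = G i k - (q * G i j') *+ (k == j).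
  rewrite mulmxBr mulmx1 -scalemxAr !mxE (bigD1 j') //= !mxE eqxx big1 ?addr0.
    by case: eqP => _ /=; rewrite ?mulr1 ?mulr0 ?mulr0n ?mulr1n.
  by move=> h /negPf hj; rewrite mxE hj mulr0.
have sGP i : (size ((G *m P) i j) <= mu j)%N.
  rewrite GPE eqxx mulr1n; case: x0 => [x0|le].
    rewrite /q x0 scale0r mul0r subr0; apply: size_leq_coef0 => //.
    by rewrite -/(l i j) lx x0 mul0r.
  have sq : (size q <= (mu j - mu j').+1)%N.
    by apply: leq_trans (size_scale_leq _ _) _; rewrite size_polyXn.
  have mE : mu j = (mu j - mu j' + mu j')%N by rewrite subnK.
  apply: size_leq_coef0.
    by apply: sizeB_bound; rewrite // mE; apply: sizeM_bound.
  rewrite coefB -/(l i j) lx mE coefM_bound // /q coefZ coefXn eqxx mulr1.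
  by rewrite subrr.
have GP0 : \det (G *m P) != 0.
  rewrite det_mulmx mulf_neq0 //.
  by move: Pu; rewrite unitmxE; apply: contraTneq => ->; rewrite unitr0.
(* Were [mu j] zero, column j of G P would vanish; hence the predecessor in [nu] is a true
   decrease. *)
have muj : (0 < mu j)%N.
  rewrite lt0n; apply: contraNneq GP0 => mj; apply/eqP.
  have c0 i : (G *m P) i j = 0.
    by apply/eqP; rewrite -size_poly_leq0; apply: leq_trans (sGP i) _; rewrite mj.
  have dz (H : 'M[{poly K}]_2) k : (forall i, H i k = 0) -> \det H = 0.
    by rewrite det2E; elim/ord2P: k => H0; rewrite !H0 ?mul0r ?mulr0 subrr.
  exact: dz c0.
pose nu k := if k == j then (mu j).-1 else mu k.
have [|k i|Q [nu' [Qu bQ sQ]]] := IH (G *m P) GP0 nu.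
- move: les muj; rewrite /nu; clear; elim/ord2P: j => /=; lia.
- rewrite /nu; case: eqP => [->|/eqP kj]; first by rewrite prednK.
  by rewrite GPE (negPf kj) subr0.
exists (P *m Q), nu'; split; first by rewrite unitmx_mul Pu.
  by rewrite mulmxA.
rewrite -sQ det_mulmx; have /size_poly1P[k k0 ->] : size (\det P) == 1%N.
  by move: Pu; rewrite unitmxE poly_unitE => /andP[].
by rewrite mulrC mul_polyC size_scale.
Qed.

End ColumnReduction.

Lemma basis_unitmx (R : comUnitRingType) (M : lmodType R) r (e : 'I_r -> M)
    (P : 'M[R]_r) :
  is_basis e -> P \in unitmx -> is_basis (fun i => \sum_j P i j *: e j).
Proof. by move=> eb Pu; apply: (basis_mx eb (mulmxV Pu) (mulVmx Pu)). Qed.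

Section Reglue.
Variables (A : comNzRingType) (F : p1sheaf A).

(** Only the difference of the exponents, the degree of the line bundle, is intrinsic. *)
Lemma reglue N d N' d' (x : sec1 F) (y : sec0 F) : (N' + d = d' + N)%N ->
  'X^N' *: res1 x = 'X^d' *: res0 y -> 'X^N *: res1 x = 'X^d *: res0 y.
Proof.
move=> e xy; apply: (@sec01_Xn_inj _ F N').
by rewrite /= scalerA mulrC -scalerA xy !scalerA -!exprD addnC -e.
Qed.

End Reglue.

(** Birkhoff factorization: the reduced matrix G P equals Q(1/t) diag(t^d), and comparing degrees
    makes det Q constant. Then P is absorbed by the frame on U0 and Q by the frame on U1. *)
Lemma degree2_diagonal (K : fieldType) (V : p1sheaf K) (deg : int) :
  has_degree 2 V deg -> exists (e0 : 'I_2 -> sec0 V) (e1 : 'I_2 -> sec1 V) N d,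
    [/\ is_basis e0, is_basis e1,
        forall i, 'X^N *: res1 (e1 i) = 'X^(d i) *: res0 (e0 i)
      & deg = (d i0 + d i1)%:Z - (2 * N)%:Z].
Proof.
move=> [e0 [e1 [N [G [c [n [b0 b1 gl [c0 detG] ->]]]]]]].
have G0 : \det G != 0 by rewrite detG scaler_eq0 negb_or c0 -size_poly_eq0 size_polyXn.
have [P [d [Pu bH sG]]] := column_reduction G0.
have nE : n = (d i0 + d i1)%N.
  by move: sG; rewrite detG size_scale // size_polyXn => -[].
pose H := G *m P; pose f0 i := \sum_j invmx P i j *: e0 j.
have f0b : is_basis f0 by apply: basis_unitmx; rewrite ?unitmx_inv.
have glH i : 'X^N *: res1 (e1 i) = \sum_j H i j *: res0 (f0 j).
  rewrite gl; have -> : G = H *m invmx P by rewrite /H -mulmxA mulmxV // mulmx1.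
  under eq_bigr do rewrite mxE scaler_suml.
  rewrite exchange_big; apply: eq_bigr => j _; rewrite res0_sum scaler_sumr.
  by apply: eq_bigr => l _; rewrite res0Z scalerA.
have [k k0 detH] : exists2 k : K, k != 0 & \det H = k%:P * 'X^n.
  have /size_poly1P[k k0 kE] : size (\det P) == 1%N.
    by move: Pu; rewrite unitmxE poly_unitE => /andP[].
  exists (k * c); first by rewrite mulf_neq0.
  by rewrite det_mulmx detG kE mulrC -mul_polyC mulrA polyCM.
pose Q := \matrix_(i, j) revp (d j) (H i j).
have QE i j : lembed 'X^(d j) * lneg (Q i j) = lembed (H i j).
  by rewrite mxE lpos_neg ?size_revp // revpK.
have detQ : \det Q = k%:P.
  apply/eqP; rewrite -subr_eq0; apply/eqP; apply: (@lneg_eq0 K).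
  apply: (@lposXn_inj K (d i0 + d i1)); rewrite mulr0.
  rewrite rmorphB /= lnegC mulrBr -rmorphM /= (mulrC 'X^_) -nE -detH !det2E nE.
  rewrite !rmorphB !rmorphM /= exprD -!QE; ring.
have kQ : k^-1%:P * \det Q = 1 by rewrite detQ -polyCM mulVf.
pose T := k^-1%:P *: \adj Q; pose f1 i := \sum_j T i j *: e1 j.
have f1b : is_basis f1.
  apply: (@basis_mx _ _ _ e1 T Q b1).
    by rewrite /T -scalemxAl mul_adj_mx scale_scalar_mx kQ.
  by rewrite /T -scalemxAr mul_mx_adj scale_scalar_mx kQ.
exists f0, f1, N, d; split=> //; last by rewrite nE.
have res1_rev i j y : 'X^(d j) *: res1 (Q i j *: y) = H i j *: res1 y.
  by rewrite mxE res1Z ?size_revp // revpK.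
have detHE : H i0 i0 * H i1 i1 - H i0 i1 * H i1 i0 = k%:P * 'X^n by rewrite -det2E.
(* The rows of the inverse of Q, taken from the adjugate. Column r of Q acts on U01 as column r of H
   divided by t^(d r). *)
have glue2 x y r : 'X^(d r) *: ('X^N *: res1 (k^-1%:P *:
    (Q x r *: e1 y - Q y r *: e1 x))) =
    k^-1%:P *: (H x r *: ('X^N *: res1 (e1 y)) - H y r *: ('X^N *: res1 (e1 x))).
  rewrite res1C res1B (scalerCA 'X^N) (scalerCA 'X^(d r)) !scalerBr.
  by rewrite !(scalerCA 'X^(d r) 'X^N) !res1_rev !(scalerCA 'X^N).
have f1E : (f1 i0 = k^-1%:P *: (Q i1 i1 *: e1 i0 - Q i0 i1 *: e1 i1)) *
           (f1 i1 = k^-1%:P *: (Q i0 i0 *: e1 i1 - Q i1 i0 *: e1 i0)).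
  have TE i j : T i j = k^-1%:P * \adj Q i j by rewrite mxE.
  by rewrite /f1 !sum2E !TE !adj2E -!scalerA -!scalerDr !scaleNr (addrC (- _)).
(* Cramer's rule: this combination eliminates one of two frame vectors. *)
have elim p q r s (y z : sec01 V) :
    p *: (q *: y + r *: z) - r *: (s *: y + p *: z) = (p * q - r * s) *: y.
  rewrite !scalerDr !scalerA opprD (mulrC r p) addrACA subrr addr0.
  by rewrite scalerBl.
have kk y : k^-1%:P *: ((k%:P * 'X^n) *: y) = 'X^n *: y :> sec01 V.
  by rewrite scalerA mulrA -polyCM mulVf // mul1r.
apply: ord2P.
  apply: (@sec01_Xn_inj _ V (d i1)); rewrite /= f1E glue2 !glH !sum2E elim.
  by rewrite (mulrC (H i1 i1)) detHE kk nE scalerA -exprD addnC.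
apply: (@sec01_Xn_inj _ V (d i0)); rewrite /= f1E glue2 !glH !sum2E.
rewrite ![_ *: res0 (f0 i0) + _]addrC elim (mulrC (H i1 i0)).
by rewrite detHE kk nE scalerA -exprD.
Qed.

Lemma degree1_frame (K : fieldType) (L : p1sheaf K) (deg : int) :
  has_degree 1 L deg -> exists (l0 : sec0 L) (l1 : sec1 L) (a b : nat),
    [/\ is_basis (fun _ : 'I_1 => l0), is_basis (fun _ : 'I_1 => l1),
        'X^b *: res1 l1 = 'X^a *: res0 l0 & deg = a%:Z - b%:Z].
Proof.
move=> [e0 [e1 [N [G [c [n [b0 b1 gl [c0 detG] ->]]]]]]].
exists (e0 ord0), (c^-1%:P *: e1 ord0), n, N; split.
- by apply: is_basis_ext b0 => i; rewrite ord1.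
- have := @basis_mx _ _ _ e1 (c^-1%:P%:M) (c%:P%:M) b1.
  rewrite -!scalar_mxM -!polyCM mulVf // mulfV // => /(_ erefl erefl).
  by apply: is_basis_ext => i; rewrite big_ord1 mxE ord1 eqxx.
- rewrite res1C scalerA mulrC -scalerA gl big_ord1.
  have -> : G ord0 ord0 = c *: 'X^n by rewrite -detG det_mx11.
  by rewrite scalerA -mul_polyC mulrA -polyCM mulVf // mul1r.
by rewrite mul1n.
Qed.

(** * Extensions of line bundles *)

Definition mx2 (R : Type) (a b c d : R) : 'M[R]_2 :=
  \matrix_(i, j) if i == i0 then if j == i0 then a else b
                 else if j == i0 then c else d.

Lemma mx2E (R : Type) (a b c d : R) : (mx2 a b c d i0 i0 = a) *
  (mx2 a b c d i0 i1 = b) * (mx2 a b c d i1 i0 = c) * (mx2 a b c d i1 i1 = d).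
Proof. by rewrite !mxE. Qed.

Lemma map_mx2 (R R' : Type) (f : R -> R') a b c d :
  map_mx f (mx2 a b c d) = mx2 (f a) (f b) (f c) (f d).
Proof. by apply/matrixP; apply: ord2P; apply: ord2P; rewrite mxE !mx2E. Qed.

(* The gluing matrix of an extension of O(be - N) by O(al - N), whose class is
   proportional to [u]. *)
Definition ext_mx (A : comNzRingType) (al be ga : nat) (u : A) : 'M[{poly A}]_2 :=
  mx2 'X^be (- (u%:P * 'X^ga)) 0 'X^al.

Lemma map_ext_mx (A B : comNzRingType) (f : {rmorphism A -> B}) al be ga u :
  map_mx (map_poly f) (ext_mx al be ga u) = ext_mx al be ga (f u).
Proof.
rewrite /ext_mx map_mx2 rmorph0 rmorphN rmorphM !rmorphXn /=.
by rewrite map_polyX map_polyC.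
Qed.

(** The exponent is all that the matrix remembers of a given form, so the special members of all
    families coincide. *)
Lemma ext_mx0 (A : comNzRingType) al be ga ga' :
  ext_mx al be ga (0 : A) = ext_mx al be ga' 0.
Proof. by rewrite /ext_mx !mul0r. Qed.

Lemma det_ext_mx (A : comNzRingType) al be ga (u : A) :
  \det (ext_mx al be ga u) = 'X^(be + al).
Proof. by rewrite det2E !mx2E mulr0 subr0 exprD. Qed.

Section Frames.
Variables (K : fieldType) (V : p1sheaf K) (N al be ga : nat).
Hypotheses (alga : (al <= ga)%N) (gabe : (ga <= be)%N).

(** For u = 0 the matrix is diagonal already. Otherwise t^ga is a pivot, and the bundle is O(ga - N)
    + O(al + be - ga - N). *)
Lemma extension_diagonal (e0 : 'I_2 -> sec0 V) (e1 : 'I_2 -> sec1 V) (u : K) :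
  framed e0 e1 N (ext_mx al be ga u) ->
  exists (f0 : 'I_2 -> sec0 V) (f1 : 'I_2 -> sec1 V) (d : 'I_2 -> nat),
    [/\ is_basis f0, is_basis f1,
        forall i, 'X^N *: res1 (f1 i) = 'X^(d i) *: res0 (f0 i)
      & forall i, (al <= d i)%N].
Proof.
move=> [b0 b1 gl]; have gl0 := gl i0; have gl1 := gl i1.
move: gl0 gl1; rewrite !sum2E !mx2E scale0r add0r => gl0 gl1.
have [u0|u0] := eqVneq u 0.
  exists e0, e1, (fun i => if i == i0 then be else al); split=> //.
    by apply: ord2P => //=; rewrite gl0 u0 mul0r oppr0 scale0r addr0.
  by apply: ord2P => //=; apply: leq_trans gabe.
pose P0 := mx2 'X^(be - ga) (- u%:P) 1 0; pose P1 := mx2 1 0 'X^(ga - al) u%:P.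
have u_unit : u%:P \is a GRing.unit by rewrite poly_unitE size_polyC u0 coefC eqxx unitfE.
exists (fun i => \sum_j P0 i j *: e0 j), (fun i => \sum_j P1 i j *: e1 j).
exists (fun i => if i == i0 then ga else (al + be - ga)%N); split.
- by apply: basis_unitmx => //; rewrite unitmxE det2E !mx2E mulr0 mulr1 sub0r opprK.
- by apply: basis_unitmx => //; rewrite unitmxE det2E !mx2E mul1r mul0r subr0.
- apply: ord2P; rewrite !sum2E !mx2E /= !scale1r !scale0r !addr0.
    rewrite gl0 !scaleNr res0B !res0Z scalerBr !scalerA -exprD subnKC //.
    by rewrite (mulrC 'X^ga).
  apply: (@sec01_Xn_inj _ V (ga - al)).
  rewrite /= res1D res1C (scalerCA 'X^(ga - al) 'X^N) scalerDr res1Xn scalerDr gl0.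
  rewrite (scalerCA 'X^(ga - al) u%:P) (scalerCA 'X^N u%:P) (scalerCA 'X^N) gl1.
  rewrite !scalerA -mulrA -!exprD subnK // scaleNr addrNK.
  by congr ('X^_ *: _); lia.
- by apply: ord2P => //=; lia.
Qed.

(* Splits off the subbundle spanned by a section of V(N - al) which does not
   vanish anywhere. *)
Lemma diagonal_extension (f0 : 'I_2 -> sec0 V) (f1 : 'I_2 -> sec1 V) (d : 'I_2 -> nat) :
  is_basis f0 -> is_basis f1 ->
  (forall i, 'X^N *: res1 (f1 i) = 'X^(d i) *: res0 (f0 i)) ->
  d i0 = ga -> d i1 = (al + be - ga)%N ->
  exists (e0 : 'I_2 -> sec0 V) (e1 : 'I_2 -> sec1 V),
    framed e0 e1 N (ext_mx al be ga 1).
Proof.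
move=> b0 b1 gl d0 d1; have gl0 := gl i0; have gl1 := gl i1.
rewrite {}d0 in gl0; rewrite {}d1 in gl1.
(* The inverses of the base changes in [extension_diagonal] at u = 1. The second new vector is the
   section: it has a coefficient -1 on U0 and 1 on U1, so it vanishes nowhere. *)
pose P0 := mx2 0 1 (- 1) 'X^(be - ga) : 'M[{poly K}]_2.
pose P1 := mx2 1 0 (- 'X^(ga - al)) 1 : 'M[{poly K}]_2.
exists (fun i => \sum_j P0 i j *: f0 j), (fun i => \sum_j P1 i j *: f1 j); split.
- apply: basis_unitmx => //.
  by rewrite unitmxE det2E !mx2E mul0r mulrN1 sub0r opprK unitr1.
- by apply: basis_unitmx => //; rewrite unitmxE det2E !mx2E mulr1 mul0r subr0 unitr1.
apply: ord2P; rewrite !sum2E !mx2E !scale1r !scale0r ?addr0 ?add0r ?polyC1 ?mul1r.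
  rewrite gl0 !scaleNr scale1r (addrC (- f0 i0)) res0B res0Z scalerBr scalerA.
  by rewrite -exprD subnKC // opprB addrC subrK.
apply: (@sec01_Xn_inj _ V (ga - al)); rewrite /= !scaleNr scale1r.
rewrite (addrC (- f0 i0)) (addrC (- _)) res0B res0Z res1B.
rewrite (scalerCA 'X^(ga - al) 'X^N) scalerBr res1Xn scalerBr gl0 (scalerCA 'X^N).
rewrite gl1 !scalerBr !scalerA -!exprD.
by congr ('X^_ *: _ - 'X^_ *: _); lia.
Qed.

End Frames.

(** * The family *)

Section ExtensionSheaf.
Variables (A : comNzRingType) (N al be ga : nat) (u : A).

Let G := ext_mx al be ga u.

Definition ext_gluing : 'M[laurent A]_2 := lneg 'X^N *: map_mx (@lembed A) G.
Definition ext_gluing_inv : 'M[laurent A]_2 :=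
  (lembed 'X^N * lneg 'X^(be + al)) *: map_mx (@lembed A) (\adj G).

Fact ext_gluingK : ext_gluing *m ext_gluing_inv = 1%:M.
Proof.
rewrite /ext_gluing /ext_gluing_inv -scalemxAl -scalemxAr scalerA -map_mxM.
rewrite mul_mx_adj det_ext_mx map_scalar_mx scale_scalar_mx; congr _%:M.
by rewrite mulrA (mulrC (lneg _)) lposnegXn mul1r mulrC lposnegXn.
Qed.

Definition ext_sheaf := glued_sheaf ext_gluingK.

Lemma ext_framed : @framed A 2 ext_sheaf
  (fun i => delta_mx 0 i) (fun i => delta_mx 0 i) N G.
Proof. by apply: glued_framed; rewrite scalerA lposnegXn scale1r. Qed.

End ExtensionSheaf.

Section LineSheaf.
Variables (A : comNzRingType) (a b : nat).

Definition line_gluing (a b : nat) : laurent A := lneg 'X^b * lembed 'X^a.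

Fact line_gluingK : line_gluing a b * line_gluing b a = 1.
Proof.
rewrite /line_gluing -mulrA (mulrA (lembed _)) lposnegXn mul1r mulrC.
exact: lposnegXn.
Qed.

Definition line_sheaf := glued_sheaf (scalar_mx_inv line_gluingK).

Lemma line_framed : @framed A 1 line_sheaf
  (fun i => delta_mx 0 i) (fun i => delta_mx 0 i) b ('X^a)%:M.
Proof.
apply: glued_framed; rewrite map_scalar_mx scale_scalar_mx; congr _%:M.
by rewrite mulrA lposnegXn mul1r.
Qed.

End LineSheaf.

Lemma framed_bundle (A : comNzRingType) r (F : p1sheaf A) e0 e1 N G :
  @framed A r F e0 e1 N G -> vector_bundle r F.
Proof. by case=> b0 b1 _; split; apply: basis_locally_free; eassumption. Qed.

Section Sections.
Variables (A B : comNzRingType) (f : {rmorphism A -> B}).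
Variables (F : p1sheaf A) (F' : p1sheaf B) (s : p1map f F F').

Fact map_section_glue (h : global_section F) :
  res0 (map0 s (gs0 h)) = res1 (map1 s (gs1 h)).
Proof. by rewrite -map_res0 gs_glue map_res1. Qed.

Definition map_section h : global_section F' := GlobalSection (map_section_glue h).

End Sections.

Fact zero_section_glue (A : comNzRingType) (F : p1sheaf A) :
  res0 (0 : sec0 F) = res1 0.
Proof. by rewrite res0_0 res1_0. Qed.

Definition zero_section (A : comNzRingType) (F : p1sheaf A) : global_section F :=
  GlobalSection (zero_section_glue F).

Section Arrows.
Variables (A B : comNzRingType) (f : {rmorphism A -> B}).
Variables (x : lbqf A) (y : lbqf B).
Variables (e0 : 'I_2 -> sec0 (lV x)) (e1 : 'I_2 -> sec1 (lV x)).
Variables (l0 : 'I_1 -> sec0 (lL x)) (l1 : 'I_1 -> sec1 (lL x)).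
Hypotheses (e0b : is_basis e0) (e1b : is_basis e1).
Hypotheses (l0b : is_basis l0) (l1b : is_basis l1).
Variables (v : p1map f (lV x) (lV y)) (t : p1map f (lL x) (lL y)).
Hypotheses (vp : is_pullback v) (tp : is_pullback t).

(** The map induced on Sym^2 V (x) L is only known to exist, so the condition on p is asked of every
    map compatible with the products. *)
Lemma lbqf_arrow_of_maps :
  (forall s : p1map f (lSym x) (lSym y),
    (forall z w m, map0 s (mul0 (lmul x) z w m) =
       mul0 (lmul y) (map0 v z) (map0 v w) (map0 t m)) ->
    (forall z w m, map1 s (mul1 (lmul x) z w m) =
       mul1 (lmul y) (map1 v z) (map1 v w) (map1 t m)) ->
    map0 s (gs0 (lp x)) = gs0 (lp y) /\ map1 s (gs1 (lp x)) = gs1 (lp y)) ->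
  inhabited (lbqf_arrow f x y).
Proof.
have [s [sE0 sE1]] := sym2_p1map (lmul x) (lmul y) e0b e1b l0b l1b v t.
by move=> /(_ s sE0 sE1) [pE0 pE1]; exists; apply: (LbqfArrow vp tp sE0 sE1 pE0 pE1).
Qed.

End Arrows.

(** The hypothesis equates matrices, not parameters, so that [ga] and [ga'] may differ when the
    parameter is 0. *)
Lemma ext_maps (A B : comNzRingType) (f : {rmorphism A -> B}) N al be a b ga ga'
    (u : A) (u' : B) :
  ext_mx al be ga (f u) = ext_mx al be ga' u' ->
  exists (v : p1map f (ext_sheaf N al be ga u) (ext_sheaf N al be ga' u'))
         (t : p1map f (line_sheaf A a b) (line_sheaf B a b)),
    [/\ is_pullback v, is_pullback t,
      forall i, (map0 v (delta_mx 0 i) = delta_mx 0 i) /\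
                (map1 v (delta_mx 0 i) = delta_mx 0 i)
    & forall i, (map0 t (delta_mx 0 i) = delta_mx 0 i) /\
                (map1 t (delta_mx 0 i) = delta_mx 0 i)].
Proof.
move=> uu'.
have frV := ext_framed N al be ga u; have [_ _ glV] := ext_framed N al be ga' u'.
have frL := line_framed A a b; have [_ _ glL] := line_framed B a b.
have [v [v0 v1]] : exists v : p1map f (ext_sheaf N al be ga u) (ext_sheaf N al be ga' u'),
    (forall i, map0 v (delta_mx 0 i) = delta_mx 0 i) /\
    (forall i, map1 v (delta_mx 0 i) = delta_mx 0 i).
  apply: (p1map_of_frames frV) => i; rewrite glV -uu' -map_ext_mx.
  by apply: eq_bigr => j _; rewrite mxE.
have [t [t0 t1]] : exists t : p1map f (line_sheaf A a b) (line_sheaf B a b),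
    (forall i, map0 t (delta_mx 0 i) = delta_mx 0 i) /\
    (forall i, map1 t (delta_mx 0 i) = delta_mx 0 i).
  apply: (p1map_of_frames frL) => i; rewrite glL; apply: eq_bigr => j _.
  by rewrite !mxE rmorphMn /= rmorphXn /= map_polyX.
exists v, t; split=> //.
- apply: (is_pullback_of_frames frV).
    by apply: is_basis_ext (basis_delta _ _) => i; rewrite /= v0.
  by apply: is_basis_ext (basis_delta _ _) => i; rewrite /= v1.
apply: (is_pullback_of_frames frL).
  by apply: is_basis_ext (basis_delta _ _) => i; rewrite /= t0.
by apply: is_basis_ext (basis_delta _ _) => i; rewrite /= t1.
Qed.

(* diag(1, w) carries the extension class to its multiple by [w]; scaling L by
   [w] as well makes the image of any form vanish at w = 0. *)
Lemma scaled_maps (A B : comNzRingType) (f : {rmorphism A -> B}) (V L : p1sheaf A)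
    (V' L' : p1sheaf B) e0 e1 l0 l1 e0' e1' l0' l1' N al be ga a b (w : B) :
  @framed A 2 V e0 e1 N (ext_mx al be ga 1) -> @framed A 1 L l0 l1 b ('X^a)%:M ->
  @framed B 2 V' e0' e1' N (ext_mx al be ga w) -> @framed B 1 L' l0' l1' b ('X^a)%:M ->
  exists (v : p1map f V V') (t : p1map f L L'),
    (forall i, (map0 v (e0 i) = (if i == i0 then 1 else w%:P) *: e0' i) /\
               (map1 v (e1 i) = (if i == i0 then 1 else w%:P) *: e1' i)) /\
    (forall i, (map0 t (l0 i) = w%:P *: l0' i) /\ (map1 t (l1 i) = w%:P *: l1' i)).
Proof.
move=> frV frL [_ _ glV'] [_ _ glL'].
have [v [v0 v1]] : exists v : p1map f V V',
    (forall i, map0 v (e0 i) = (if i == i0 then 1 else w%:P) *: e0' i) /\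
    (forall i, map1 v (e1 i) = (if i == i0 then 1 else w%:P) *: e1' i).
  apply: (p1map_of_frames frV); have gl0 := glV' i0; have gl1 := glV' i1.
  move: gl0 gl1; rewrite !sum2E !mx2E scale0r add0r => gl0 gl1.
  apply: ord2P; rewrite sum2E !mx2E /= !scale1r ?rmorph0 ?scale0r ?add0r.
    rewrite gl0 rmorphN /= polyC1 mul1r !rmorphXn /= map_polyX res0Z !scaleNr.
    by rewrite scalerA mulrC.
  by rewrite res1C scalerCA gl1 res0Z scalerCA rmorphXn /= map_polyX.
have [t [t0 t1]] : exists t : p1map f L L',
    (forall i, map0 t (l0 i) = w%:P *: l0' i) /\
    (forall i, map1 t (l1 i) = w%:P *: l1' i).
  apply: (p1map_of_frames frL) => i; rewrite res1C scalerCA glL' !big_ord1.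
  by rewrite ord1 !mxE eqxx res0Z scalerCA rmorphMn /= rmorphXn /= map_polyX.
by exists v, t.
Qed.

(** For w nonzero in a field, diag(1, w) and w are invertible, so the scaled images of the frames
    are bases. *)
Lemma scaled_pullback (A : comNzRingType) (B : fieldType) (f : {rmorphism A -> B})
    (V L : p1sheaf A) (V' L' : p1sheaf B) e0 e1 l0 l1 e0' e1' l0' l1' N b
    (G G' : 'M_2) (D D' : 'M_1) (w : B) (v : p1map f V V') (t : p1map f L L') :
  @framed A 2 V e0 e1 N G -> @framed A 1 L l0 l1 b D ->
  @framed B 2 V' e0' e1' N G' -> @framed B 1 L' l0' l1' b D' -> w != 0 ->
  (forall i, (map0 v (e0 i) = (if i == i0 then 1 else w%:P) *: e0' i) /\
             (map1 v (e1 i) = (if i == i0 then 1 else w%:P) *: e1' i)) ->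
  (forall i, (map0 t (l0 i) = w%:P *: l0' i) /\ (map1 t (l1 i) = w%:P *: l1' i)) ->
  is_pullback v /\ is_pullback t.
Proof.
move=> frV frL [bV0 bV1 _] [bL0 bL1 _] w0 vE tE.
have wu : w%:P \is a GRing.unit by rewrite poly_unitE size_polyC w0 coefC eqxx unitfE.
have Pu : mx2 1 0 0 w%:P \in unitmx by rewrite unitmxE det2E !mx2E mul1r mul0r subr0.
have Qu : w%:P%:M \in @unitmx {poly B} 1 by rewrite unitmxE det_scalar1.
split.
  apply: (is_pullback_of_frames frV).
    apply: is_basis_ext (basis_unitmx bV0 Pu); apply: ord2P;
      by rewrite /= sum2E !mx2E !scale0r ?addr0 ?add0r (vE _).1.
  apply: is_basis_ext (basis_unitmx bV1 Pu); apply: ord2P;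
    by rewrite /= sum2E !mx2E !scale0r ?addr0 ?add0r (vE _).2.
apply: (is_pullback_of_frames frL).
  apply: is_basis_ext (basis_unitmx bL0 Qu) => i.
  by rewrite /= big_ord1 !ord1 mxE (tE _).1.
apply: is_basis_ext (basis_unitmx bL1 Qu) => i.
by rewrite /= big_ord1 !ord1 mxE (tE _).2.
Qed.

(** Maps out of Sym^2 V (x) L are determined on products, so a composite of induced maps can be
    identified on frames of V and L. This is how p is followed through the family. *)
Lemma sym2_comp (R R' R'' : comNzRingType) (phi : {rmorphism R -> R'})
    (psi : {rmorphism R' -> R''}) (chi : {rmorphism R -> R''})
    (V L S : lmodType R) (mu : V -> V -> L -> S)
    (V' L' S' : lmodType R') (mu' : V' -> V' -> L' -> S')
    (V'' L'' S'' : lmodType R'') (mu'' : V'' -> V'' -> L'' -> S'')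
    (e : 'I_2 -> V) (l : 'I_1 -> L)
    (u1 : V -> V') (t1 : L -> L') (s1 : S -> S')
    (u2 : V' -> V'') (t2 : L' -> L'') (s2 : S' -> S'')
    (u3 : V -> V'') (t3 : L -> L'') (s3 : S -> S'') :
  chi =1 psi \o phi -> is_basis e -> is_basis l -> is_sym2_tensor mu ->
  semilinear phi u1 -> semilinear phi t1 -> semilinear phi s1 ->
  semilinear psi u2 -> semilinear psi t2 -> semilinear psi s2 ->
  semilinear chi u3 -> semilinear chi t3 -> semilinear chi s3 ->
  (forall v w x, s1 (mu v w x) = mu' (u1 v) (u1 w) (t1 x)) ->
  (forall v w x, s2 (mu' v w x) = mu'' (u2 v) (u2 w) (t2 x)) ->
  (forall v w x, s3 (mu v w x) = mu'' (u3 v) (u3 w) (t3 x)) ->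
  (forall i, u2 (u1 (e i)) = u3 (e i)) -> (forall i, t2 (t1 (l i)) = t3 (l i)) ->
  s2 \o s1 =1 s3.
Proof.
move=> pc eb lb mU u1l t1l s1l u2l t2l s2l u3l t3l s3l s1E s2E s3E uE tE.
have comp (M : lmodType R) (M' : lmodType R') (M'' : lmodType R'')
    (f : M -> M') (h : M' -> M'') :
    semilinear phi f -> semilinear psi h -> semilinear chi (h \o f).
  by move=> fl hl; apply: semilinear_comp fl hl pc.
have u21 := basis_ext eb (comp _ _ _ _ _ u1l u2l) u3l uE.
have t21 := basis_ext lb (comp _ _ _ _ _ t1l t2l) t3l tE.
apply: (sym2_ext eb lb mU (comp _ _ _ _ _ s1l s2l) s3l) => v w x.
by rewrite /= s1E s2E s3E -u21 -u21 -t21.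
Qed.

(** * The identity arrow, along which conditions on all fibers are read at a point itself *)

Section Identity.
Variables (k : fieldType) (A : kalg k).

Fact id_khom_str (c : k) : idfun (kstr A c) = kstr A c. Proof. by []. Qed.
Definition id_khom : khom A A := KHom id_khom_str.

Lemma id_semilinear (M : lmodType {poly A}) : semilinear (map_poly id_khom) (@id M).
Proof. by move=> p x y; rewrite map_poly_id. Qed.

Definition id_p1map (F : p1sheaf A) : p1map id_khom F F :=
  P1Map (@id_semilinear _) (@id_semilinear _) (@id_semilinear _)
    (fun=> erefl) (fun=> erefl).

Lemma id_basechange (M : lmodType {poly A}) :
  is_basechange (map_poly id_khom) (@id M).
Proof.
split=> [|N' v vl]; first exact: id_semilinear.
split=> [|h h' hh' x]; last exact: hh'.
have [|h hE] := @ex_linear _ _ _ v; last by exists h.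
by move=> p x y; rewrite vl map_poly_id.
Qed.

Lemma id_pullback (F : p1sheaf A) : is_pullback (id_p1map F).
Proof. by split; apply: id_basechange. Qed.

End Identity.

Lemma point_diagonal (k : fieldType) (g n : int) (K : kfield k) (x : ob (Jbar_bd k g n) K)
    (X := proj1_sig (proj1_sig x)) :
  exists (f0 : 'I_2 -> sec0 (lV X)) (f1 : 'I_2 -> sec1 (lV X))
    (l0 : sec0 (lL X)) (l1 : sec1 (lL X)) (N' a' b' : nat) (d : 'I_2 -> nat),
    [/\ is_basis f0 /\ is_basis f1,
        is_basis (fun _ : 'I_1 => l0) /\ is_basis (fun _ : 'I_1 => l1),
        (forall i, 'X^N' *: res1 (f1 i) = 'X^(d i) *: res0 (f0 i)) /\
        'X^b' *: res1 l1 = 'X^a' *: res0 l0,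
        (d i0 + d i1)%:Z - (2 * N')%:Z = n - g - 1 /\ a'%:Z - b'%:Z = 2 * g - n + 2
      & forall i, (N' + N' + b' <= d i + d i + a')%N].
Proof.
have [dV' [dL' [degV degL eg en]]] := proj2_sig (proj1_sig x) K (id_khom K)
  _ _ _ _ (id_pullback (lV X)) (id_pullback (lL X)).
have [f0 [f1 [N' [d [b0 b1 gl dE]]]]] := degree2_diagonal degV.
have [l0 [l1 [a' [b' [c0 c1 lE lD]]]]] := degree1_frame degL.
exists f0, f1, l0, l1, N', a', b', d; split=> //.
  by rewrite -dE -lD; split; lia.
apply: (diag_globally_generated (lmul X) b0 b1 c0 c1 gl lE).
(* L has the degree 2g - n + 2, so it can serve as the twisting sheaf itself. *)
apply: (proj2_sig x K (id_khom K) _ _ (id_pullback (lV X)) (lL X) _ _ (lmul X)).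
by exists l0, l1, a', b'; split=> //; lia.
Qed.

(** * The affine line over K, its generic point and its origin *)

Section AffineLine.
Variables (k : fieldType) (K : kfield k).

Definition affine_line : kalg k :=
  KAlg (GRing.RMorphism.clone _ _ (polyC \o kfstr K) _ : {rmorphism k -> {poly kfcar K}}).

Definition line_generic_point : kfield k :=
  KField (GRing.RMorphism.clone _ _ (@FracField.tofrac {poly kfcar K} \o (polyC \o kfstr K)) _
    : {rmorphism k -> {fraction {poly kfcar K}}}).

Definition line_const : khom K affine_line :=
  @KHom k K affine_line (polyC : {rmorphism kfcar K -> {poly kfcar K}}) (fun=> erefl).

Definition line_generic : khom affine_line line_generic_point :=
  @KHom k affine_line line_generic_point
    (@FracField.tofrac {poly kfcar K} : {rmorphism _ -> _}) (fun=> erefl).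

Definition generic_const : khom K line_generic_point :=
  @KHom k K line_generic_point
    (GRing.RMorphism.clone _ _ (@FracField.tofrac {poly kfcar K} \o polyC) _) (fun=> erefl).

Fact line_origin_str c :
  horner_eval (0 : kfcar K) (kstr affine_line c) = kstr K c.
Proof. by rewrite /horner_eval hornerC. Qed.

Definition line_origin : khom affine_line K :=
  @KHom k affine_line K
    (horner_eval (0 : kfcar K) : {rmorphism {poly kfcar K} -> kfcar K}) line_origin_str.

Lemma generic_constE : generic_const =1 line_generic \o line_const.
Proof. by []. Qed.

Lemma line_origin_const : cancel line_const line_origin.
Proof. by move=> c; apply: hornerC. Qed.

Lemma line_generic_inj (c : affine_line) : line_generic c = 0 -> c = 0.
Proof. by move=> /eqP; rewrite tofrac_eq0 => /eqP. Qed.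

Lemma line_generic_X : line_generic 'X != 0 :> kfcar line_generic_point.
Proof. by rewrite tofrac_eq0 polyX_eq0. Qed.

Lemma line_origin_X : line_origin 'X = 0.
Proof. exact: hornerX. Qed.

End AffineLine.

(* Degrees are written as differences of natural numbers: V is an extension of
   O(be - N) by O(al - N), L = O(a - b), and i0 = al - N. *)
Section Family.
Variables (k : fieldType) (g n : int) (N al be a b : nat).
Hypothesis albe : (al <= be)%N.
Hypothesis gg : (N + N + b <= al + al + a)%N.
Hypothesis dV : (al + be)%:Z - (2 * N)%:Z = n - g - 1.
Hypothesis dL : a%:Z - b%:Z = 2 * g - n + 2.

Section Object.
Variables (ga : nat) (alga : (al <= ga)%N) (gabe : (ga <= be)%N).
Variables (A : kalg k) (u : A).

Definition fam_V := ext_sheaf N al be ga u.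
Definition fam_L := line_sheaf A a b.
Definition fam_S := glued_sheaf
  (sym2_mx_mul (ext_gluingK N al be ga u) (line_gluingK A a b)).
Definition fam_mul : sym2_twist fam_V fam_L fam_S := glued_sym2 _ _.

Variable p : global_section fam_S.

Definition fam_lbqf : lbqf A :=
  Lbqf (framed_bundle (ext_framed N al be ga u)) (framed_bundle (line_framed A a b))
    fam_mul p.

Fact fam_in_J : in_J g n fam_lbqf.
Proof.
move=> K phi V' L' v t vp tp.
exists (n - g - 1), (2 * g - n + 2); split; last 2 first.
- by ring.
- by ring.
- have [b0 b1 gl] := framed_pullback (ext_framed N al be ga u) vp.
  exists (map0 v \o (fun i => delta_mx 0 i)), (map1 v \o (fun i => delta_mx 0 i)).
  exists N, (map_mx (map_poly phi) (ext_mx al be ga u)), 1, (be + al)%N; split=> //.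
    by split; rewrite ?oner_neq0 // map_ext_mx det_ext_mx scale1r.
  by rewrite -dV addnC.
have [b0 b1 gl] := framed_pullback (line_framed A a b) tp.
exists (map0 t \o (fun i => delta_mx 0 i)), (map1 t \o (fun i => delta_mx 0 i)).
exists b, (map_mx (map_poly phi) ('X^a)%:M), 1, a; split=> //.
  split; rewrite ?oner_neq0 // det_mx11 !mxE eqxx mulr1n rmorphXn /= map_polyX.
  by rewrite scale1r.
by rewrite -dL mul1n.
Qed.

Fact fam_bd : bd_bundle (2 * g - n + 2) (lV fam_lbqf).
Proof.
move=> K phi V' v vp O S [l0 [l1 [a' [b' [l0b l1b mE lE]]]]] m.
have := framed_pullback (ext_framed N al be ga u) vp; rewrite map_ext_mx => fr.
have [f0 [f1 [d [b0 b1 gl ald]]]] := extension_diagonal alga gabe fr.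
apply: (globally_generated_diag m b0 b1 l0b l1b gl lE) => i.
by have := ald i; move: mE gg; rewrite -dL; lia.
Qed.

Definition fam_ob : ob (Jbar_bd k g n) A := exist _ (exist _ fam_lbqf fam_in_J) fam_bd.

End Object.

(* The form called x0 above. *)
Definition vertex (A : kalg k) : ob (Jbar_bd k g n) A :=
  fam_ob (leqnn al) albe (zero_section (fam_S al (0 : A))).

Lemma fam_arr (A B : kalg k) (f : khom A B) ga (alga : (al <= ga)%N)
    (gabe : (ga <= be)%N) ga' (alga' : (al <= ga')%N) (gabe' : (ga' <= be)%N)
    (u : A) (u' : B) (p : global_section (fam_S ga u))
    (p' : global_section (fam_S ga' u')) :
  ext_mx al be ga (f u) = ext_mx al be ga' u' ->
  (forall (v : p1map f (fam_V ga u) (fam_V ga' u')) (t : p1map f (fam_L A) (fam_L B))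
     (s : p1map f (fam_S ga u) (fam_S ga' u')),
    (forall i, (map0 v (delta_mx 0 i) = delta_mx 0 i) /\
               (map1 v (delta_mx 0 i) = delta_mx 0 i)) ->
    (forall i, (map0 t (delta_mx 0 i) = delta_mx 0 i) /\
               (map1 t (delta_mx 0 i) = delta_mx 0 i)) ->
    (forall z w m, map0 s (mul0 (fam_mul ga u) z w m) =
       mul0 (fam_mul ga' u') (map0 v z) (map0 v w) (map0 t m)) ->
    (forall z w m, map1 s (mul1 (fam_mul ga u) z w m) =
       mul1 (fam_mul ga' u') (map1 v z) (map1 v w) (map1 t m)) ->
    map0 s (gs0 p) = gs0 p' /\ map1 s (gs1 p) = gs1 p') ->
  inhabited (arr f (fam_ob alga gabe p) (fam_ob alga' gabe' p')).
Proof.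
move=> uu' pp'; have [v [t [vp tp vE tE]]] := ext_maps N a b uu'.
have [bV0 bV1 _] := ext_framed N al be ga u; have [bL0 bL1 _] := line_framed A a b.
apply: (@lbqf_arrow_of_maps A B f (fam_lbqf p) (fam_lbqf p') _ _ _ _
  bV0 bV1 bL0 bL1 v t vp tp) => s sE0 sE1.
exact: pp' vE tE sE0 sE1.
Qed.

Lemma vertex_arr (A B : kalg k) (f : khom A B) : inhabited (arr f (vertex A) (vertex B)).
Proof.
apply: fam_arr => [|v t s _ _ _ _]; first by rewrite rmorph0.
by rewrite (semilinear0 (map0_semilinear s)) (semilinear0 (map1_semilinear s)).
Qed.

(** Minimality of i0 = al - N, the competing integers being written m - N'. *)
Hypothesis al_min : forall N' m, (N' + N' + b <= m + m + a)%N -> (N' + al <= m + N)%N.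

Lemma point_frames (K : kfield k) (x : ob (Jbar_bd k g n) K)
    (X := proj1_sig (proj1_sig x)) :
  exists (ga : nat) (e0 : 'I_2 -> sec0 (lV X)) (e1 : 'I_2 -> sec1 (lV X))
    (l0 : 'I_1 -> sec0 (lL X)) (l1 : 'I_1 -> sec1 (lL X)),
    [/\ (al <= ga)%N, (ga <= be)%N, framed e0 e1 N (ext_mx al be ga 1)
      & framed l0 l1 b ('X^a)%:M].
Proof.
have [f0 [f1 [l0 [l1 [N' [a' [b' [d [[b0 b1] [c0 c1] [gl lE] [dE lD] dN]]]]]]]]] :=
  point_diagonal x.
have ald i : (N' + al <= d i + N)%N by apply: al_min; have := dN i; lia.
(* The degrees d i - N', rewritten over the common denominator t^N; by [ald] the subtraction does
   not truncate and d' i is at least [al]. *)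
pose d' i := (d i + N - N')%N.
have gl' i : 'X^N *: res1 (f1 i) = 'X^(d' i) *: res0 (f0 i).
  by apply: reglue (gl i); have := ald i; rewrite /d'; lia.
have h0 := ald i0; have h1 := ald i1.
have alga : (al <= d' i0)%N by rewrite /d'; lia.
have gabe : (d' i0 <= be)%N by rewrite /d'; lia.
have d1 : d' i1 = (al + be - d' i0)%N by rewrite /d'; lia.
have [e0 [e1 fr]] := diagonal_extension alga gabe b0 b1 gl' erefl d1.
exists (d' i0), e0, e1, (fun=> l0), (fun=> l1); split=> //; split=> // i.
rewrite big_ord1 ord1 mxE eqxx mulr1n; apply: reglue lE; lia.
Qed.

(** * Degeneration of a point to the vertex *)

Section Degeneration.
Variables (T : kspace k) (W : point_set (stack_prod (stack_of_space T) (Jbar_bd k g n))).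
Hypothesis Wcl : closed_subset W.
Variables (K F : kfield k) (B : kalg k).
Variables (const : khom K B) (gen : khom B F) (genconst : khom K F) (orig : khom B K).
Hypothesis genconstE : genconst =1 gen \o const.
Hypothesis origK : cancel const orig.
Hypothesis gen_inj : forall c : B, gen c = 0 -> c = 0.
Variable u : B.
Hypotheses (u_gen : gen u != 0 :> kfcar F) (u_orig : orig u = 0).
Variables (t : pt T K) (x : ob (Jbar_bd k g n) K).
Let X := proj1_sig (proj1_sig x).

(** Here B, F and u stand for K[u], K(u) and the parameter. On the chart given by the family, W is
    V(I); it contains the generic point, so I = 0 because B injects into F, and then W contains the
    origin as well. *)
Lemma vertex_in_closure : W (t, x) -> W (t, vertex K).
Proof.
move=> Wx; have [Wsat Wzar] := Wcl.
have [ga [e0 [e1 [l0 [l1 [alga gabe frV frL]]]]]] := point_frames x.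
have [bV0 bV1 _] := frV; have [bL0 bL1 _] := frL.
have frB := ext_framed N al be ga u; have frBL := line_framed B a b.
have frF := ext_framed N al be ga (gen u); have frFL := line_framed F a b.
(* Over B the factor u is not a unit: these maps are no arrow of the stack and only carry p into the
   family. *)
have [vB [tB [vBE tBE]]] := scaled_maps const frV frL frB frBL.
have [sB [sB0 sB1]] := sym2_p1map (lmul X) (fam_mul ga u) bV0 bV1 bL0 bL1 vB tB.
have [vF [tF [vFE tFE]]] := scaled_maps genconst frV frL frF frFL.
have [sF [sF0 sF1]] := sym2_p1map (lmul X) (fam_mul ga (gen u)) bV0 bV1 bL0 bL1 vF tF.
pose famB := fam_ob alga gabe (map_section sB (lp X)).
pose famF := fam_ob alga gabe (map_section sF (lp X)).
have [vFp tFp] := scaled_pullback frV frL frF frFL u_gen vFE tFE.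
have arr_gen : arr (genconst : khom K F) x famF.
  exact: (@LbqfArrow _ _ _ X (fam_lbqf (map_section sF (lp X))) _ _ vFp tFp
    sF sF0 sF1 erefl erefl).
have arr_spec : inhabited (arr gen famB famF).
  apply: fam_arr => [//|v r s vE rE s0 s1].
  (* Carrying p first to B and then to F agrees with carrying it directly to F, by [sym2_comp]. *)
  have pc : map_poly genconst =1 map_poly gen \o map_poly const.
    by move=> p; apply/polyP => i; rewrite /= !coef_map; exact: genconstE.
  split.
    apply: (@sym2_comp _ _ _ (map_poly const) (map_poly gen) (map_poly genconst)
      _ _ _ _ _ _ _ _ _ _ _ _ _ _ _ _ _ _ _ _ _ _ _ pc bV0 bL0 (mul0_univ (lmul X))
      (map0_semilinear vB) (map0_semilinear tB) (map0_semilinear sB)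
      (map0_semilinear v) (map0_semilinear r) (map0_semilinear s)
      (map0_semilinear vF) (map0_semilinear tF) (map0_semilinear sF) sB0 s0 sF0).
      move=> i; rewrite (vBE i).1 (vFE i).1 (semilinearZ (map0_semilinear v)) (vE i).1.
      by case: (i == i0); rewrite ?rmorph1 //= map_polyC.
    move=> i; rewrite (tBE i).1 (tFE i).1 (semilinearZ (map0_semilinear r)) (rE i).1.
    by rewrite /= map_polyC.
  apply: (@sym2_comp _ _ _ (map_poly const) (map_poly gen) (map_poly genconst)
      _ _ _ _ _ _ _ _ _ _ _ _ _ _ _ _ _ _ _ _ _ _ _ pc bV1 bL1 (mul1_univ (lmul X))
      (map1_semilinear vB) (map1_semilinear tB) (map1_semilinear sB)
      (map1_semilinear v) (map1_semilinear r) (map1_semilinear s)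
      (map1_semilinear vF) (map1_semilinear tF) (map1_semilinear sF) sB1 s1 sF1).
    move=> i; rewrite (vBE i).2 (vFE i).2 (semilinearZ (map1_semilinear v)) (vE i).2.
    by case: (i == i0); rewrite ?rmorph1 //= map_polyC.
  move=> i; rewrite (tBE i).2 (tFE i).2 (semilinearZ (map1_semilinear r)) (rE i).2.
  by rewrite /= map_polyC.
have arr_orig : inhabited (arr orig famB (vertex K)).
  apply: fam_arr => [|v r s vE rE s0 s1]; first by rewrite u_orig (ext_mx0 _ _ _ ga al).
  have pc : idfun =1 map_poly orig \o map_poly const.
    by move=> p; apply/polyP => i; rewrite /= !coef_map /= origK.
  (* At the origin the composite map on L is zero since u = 0, hence so is the one on Sym^2 V (x) L,
     and p goes to the zero section. *)
  have zl (M M' : lmodType {poly K}) : semilinear idfun (fun _ : M => 0 : M').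
    by move=> c y z; rewrite scaler0 addr0.
  split.
    apply: (@sym2_comp _ _ _ (map_poly const) (map_poly orig) idfun
      _ _ _ _ _ _ _ _ _ _ _ _ _ _ _ _ _ _ _ _ (map0 v \o map0 vB) (fun=> 0) (fun=> 0)
      pc bV0 bL0 (mul0_univ (lmul X))
      (map0_semilinear vB) (map0_semilinear tB) (map0_semilinear sB)
      (map0_semilinear v) (map0_semilinear r) (map0_semilinear s)
      (semilinear_comp (map0_semilinear vB) (map0_semilinear v) pc)
      (zl _ _) (zl _ _) sB0 s0) => //.
      by move=> y z w; rewrite (semilinear0 (tril3 (mul0_univ _).1 _ _)).
    move=> i; rewrite (tBE i).1 (semilinearZ (map0_semilinear r)) /= map_polyC.
    by rewrite [X in X%:P]u_orig scale0r.
  apply: (@sym2_comp _ _ _ (map_poly const) (map_poly orig) idfun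
    _ _ _ _ _ _ _ _ _ _ _ _ _ _ _ _ _ _ _ _ (map1 v \o map1 vB) (fun=> 0) (fun=> 0)
    pc bV1 bL1 (mul1_univ (lmul X))
    (map1_semilinear vB) (map1_semilinear tB) (map1_semilinear sB)
    (map1_semilinear v) (map1_semilinear r) (map1_semilinear s)
    (semilinear_comp (map1_semilinear vB) (map1_semilinear v) pc)
    (zl _ _) (zl _ _) sB1 s1) => //.
    by move=> y z w; rewrite (semilinear0 (tril3 (mul1_univ _).1 _ _)).
  move=> i; rewrite (tBE i).2 (semilinearZ (map1_semilinear r)) /= map_polyC.
  by rewrite [X in X%:P]u_orig scale0r.
have [I IP] := Wzar B (pmap const t, famB).
have Wgen : W (pmap genconst t, famF).
  apply: (Wsat _ _ _ _ _ Wx); apply: (@same_point_arr _ _ _ _ genconst).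
  by split.
have I0 c : I c -> c = 0.
  move=> Ic; apply: gen_inj; apply: ((IP F gen (pmap genconst t, famF) _).1 Wgen c Ic).
  have [h] := arr_spec; exists; split=> //=.
  by rewrite -(pmap_comp t genconstE).
have id_origK : id_khom K =1 orig \o const by move=> c; rewrite /= origK.
apply: ((IP K orig (t, vertex K) _).2) => [|c /I0 ->]; last exact: rmorph0.
have [h] := arr_orig; exists; split=> //=.
by rewrite -(pmap_comp t id_origK) pmap_id.
Qed.

End Degeneration.

(** The vertex is compatible with every base change, so t -> (t, vertex) acts like a section of the
    projection to T. *)
Lemma same_point_vertex (T : kspace k) (K : kfield k) (t : pt T K) (K' : kfield k)
    (t' : pt T K') :
  same_point (X := stack_of_space T) t t' ->
  same_point (X := stack_prod (stack_of_space T) (Jbar_bd k g n))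
    (t, vertex K) (t', vertex K').
Proof.
elim=> {K t K' t'} [K K' f t t' tt'|K t|K K' t t' _ IH|K K' K'' t t' t'' _ IH _ IH'].
- by have [h] := vertex_arr f; apply: (@same_point_arr _ _ _ _ f); split.
- exact: same_point_refl.
- exact: same_point_sym.
exact: same_point_trans IH'.
Qed.

Lemma bd_universally_closed : universally_closed (Jbar_bd k g n).
Proof.
move=> T W Wcl; have [Wsat Wzar] := Wcl; split.
  move=> K t K' t' tt' [K0 [z [Wz zt]]]; exists K0, z; split=> //.
  exact: same_point_trans zt tt'.
(* The image is cut out on the chart [xi] by the equations of W on the chart (xi, vertex). *)
move=> A xi; have [I IP] := Wzar A (xi, vertex A); exists I => K phi t xit.
have iffW : proj_image W t <-> W K (t, vertex K).
  split=> [[K' [[t' x] [Wz tt']]]|Wt]; last first.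
    by exists K, (t, vertex K); split=> //; apply: same_point_refl.
  have Wv : W K' (t', vertex K').
    exact: (vertex_in_closure Wcl (@generic_constE _ K')
      (@line_origin_const _ K') (@line_generic_inj _ K') (@line_generic_X _ K')
      (@line_origin_X _ K') Wz).
  exact: (Wsat _ _ _ _ (same_point_vertex tt') Wv).
rewrite iffW; apply: IP.
by have [h] := xit; have [h'] := vertex_arr phi; exists; split.
Qed.

End Family.

Lemma empty_universally_closed (k : fieldType) (X : stack_data k) :
  (forall K : kfield k, ob X K -> False) -> universally_closed X.
Proof.
move=> X0 T W _; split=> [K t K' t' _ [K0 [[? x]]]|A xi]; first by case: (X0 _ x).
(* The image is empty, and so is V(A), since 1 does not map to 0. *)
exists (fun=> True) => K phi t _; split=> [[K0 [[? x]]]|/(_ 1 Logic.I)/eqP].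
  by case: (X0 _ x).
by rewrite rmorph1 oner_eq0.
Qed.

Lemma int_sub_nat (m : int) : exists a b : nat, m = a%:Z - b%:Z.
Proof.
by case: m => c; [exists c, 0%N | exists 0%N, c.+1]; rewrite ?NegzE ?subr0 ?sub0r.
Qed.

Theorem proposition5p2 (k : fieldType) (char_k : 2%N \notin [pchar k])
    (g n : int) : universally_closed (Jbar_bd k g n).
Proof.
have [a [b abE]] := int_sub_nat (2 * g - n + 2).
(* With N = a, the condition 2 (al - N) + a - b >= 0 reads 2 al >= a + b, so the least choice is
   half of a + b, rounded up. *)
pose al := (a + b).+1./2.
have al_min N' m : (N' + N' + b <= m + m + a)%N -> (N' + al <= m + a)%N.
  by rewrite /al; lia.
have gg : (a + a + b <= al + al + a)%N by rewrite /al; lia.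
(* The test is 2 i0 <= d. If it fails, no V of degree d has both summands of degree at least i0, and
   the stack has no points. *)
have [le|lt] := boolP (al%:Z + al%:Z <= n - g - 1 + (2 * a)%:Z); last first.
  apply: empty_universally_closed => K x.
  have [f0 [f1 [l0 [l1 [N' [a' [b' [d [_ _ _ [dE lD] dN]]]]]]]]] := point_diagonal x.
  have := al_min N' (d ord0); have := al_min N' (d (lift ord0 ord0)).
  have := dN ord0; have := dN (lift ord0 ord0).
  lia.
have [be beE] : exists be : nat, be%:Z = n - g - 1 + (2 * a)%:Z - al%:Z.
  by exists (absz (n - g - 1 + (2 * a)%:Z - al%:Z)%R); lia.
apply: (bd_universally_closed (be := be) _ gg _ _ al_min); lia.
Qed.
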